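(* Let $\gamma>0$, $R>0$, $0<\lambda\le\Lambda$. Let $\Gamma$ be the graph of a function $g$ with $g(0)=0$ and $\|g\|_{C^{0,1}}\le L$. Assume that $u$ is a nonnegative solution of $$-\Delta u=f(X)u^{-\gamma}\ \text{ in }\mathcal{GC}_{3R},\qquad u=0\ \text{ on }\Gamma\cap\mathcal{GC}_{3R},$$ where $f$ is Hölder continuous with $0<\lambda\le f(X)\le\Lambda$. Suppose $\mathcal{GC}_{3R}\subseteq\overline{Cone_\Sigma}$ for an open spherical domain $\Sigma\subseteq\partial B_1$ with Lipschitz boundary such that $Cone_\Sigma$ is critical, i.e. $\phi_\Sigma=\frac{2}{1+\gamma}$. Assume further that there exists a solution $w\in C(\overline{Cone_\Sigma\cap B_1})$ to the Dirichlet problem $$-\Delta w=H_\Sigma^{-\gamma}\ \text{ in }Cone_\Sigma\cap B_1,\qquad w=0\ \text{ on }\partial(Cone_\Sigma\cap B_1).$$ Then, for some constant $C$, $$u(X)\le C R^{\frac{-2}{1+\gamma}}\|u\|_{L^\infty(\mathcal{GC}_{3R})}\cdot\left|\frac XR\right|^{\phi_\Sigma}\left(\ln\frac{2R}{|X|}\right)^{\phi_\Sigma/2}\quad\text{for all }X\in\mathcal{GC}_R.$$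
   Context: Write $X=(x',x_n)\in\mathbb{R}^{n-1}\times\mathbb{R}$; $B_r$ is the ball of radius $r$ centered at the origin. For the graph $\Gamma=\{x_n=g(x')\}$ with $g(0)=0$, the grounded cylinder is $\mathcal{GC}_r=\{(y',y_n):|y'|\le r,\ 0\le y_n-g(y')\le r\}$. Solutions are understood in the classical sense. For an open spherical domain $\Sigma\subseteq\partial B_1$ (relative topology) with Lipschitz boundary, $Cone_\Sigma=\{tY:t>0,\ Y\in\Sigma\}$; $\lambda_\Sigma$ is the first Dirichlet eigenvalue of the spherical Laplacian on $\Sigma$; and the frequency $\phi_\Sigma>0$ is defined by $\phi_\Sigma(n+\phi_\Sigma-2)=\lambda_\Sigma$. Let $E_\Sigma>0$ be the first Dirichlet eigenfunction on $\Sigma$ normalized by $\max_\Sigma E_\Sigma=1$. In polar coordinates, $H_\Sigma(r,\theta)=r^{\phi_\Sigma}E_\Sigma(\theta)$, a positive homogeneous harmonic function in $Cone_\Sigma$ vanishing on $\partial Cone_\Sigma$.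
   Formalization: The bound is proved for X in GC_R with |X| ≤ ρ, for each ρ < 2R, with C depending on ρ (and on R): for large L, GC_R can contain points with |X| ≥ 2R, where the logarithm is zero or negative and the stated inequality fails or is undefined. *)

(* Defs.v *)
From HB Require Import structures.
From mathcomp Require Import all_boot all_order all_algebra.
From mathcomp Require Import all_classical all_reals all_analysis.

Set Implicit Arguments.
Unset Strict Implicit.
Unset Printing Implicit Defensive.

Import Order.TTheory GRing.Theory Num.Theory.
Import numFieldNormedType.Exports.

Local Open Scope classical_set_scope.
Local Open Scope ring_scope.

Section EuclideanSpace.
Context {R : realType} {n : nat}.
Implicit Types (X Y : 'rV[R]_n) (r : R).

(* The library's norm on row vectors is the max norm; it induces the right
   topology, but distances and balls in the theorem are Euclidean. *)
Definition dot X Y : R := \sum_(i < n) X 0 i * Y 0 i.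
Definition enorm X : R := Num.sqrt (dot X X).

Definition eball r : set 'rV[R]_n := [set X | enorm X < r].
Definition cball r : set 'rV[R]_n := [set X | enorm X <= r].
Definition sphere : set 'rV[R]_n := [set X | enorm X = 1].

Definition lipschitz_fun (h : 'rV[R]_n -> R) : Prop :=
  exists k : R, forall X Y, `|h X - h Y| <= k * enorm (X - Y).

Definition holder_continuous (A : set 'rV[R]_n) (f : 'rV[R]_n -> R) : Prop :=
  exists alpha k : R, 0 < alpha <= 1 /\
    forall X Y, A X -> A Y -> `|f X - f Y| <= k * enorm (X - Y) `^ alpha.

(* Extended-real valued, so that an unbounded or non-Lipschitz [g] has norm
   +oo. The diagonal contributes the harmless value 0 / 0 = 0. *)
Definition C01_norm (A : set 'rV[R]_n) (g : 'rV[R]_n -> R) : \bar R :=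
  (ereal_sup [set `|g X|%:E | X in A] +
   ereal_sup [set (`|g Z.1 - g Z.2| / enorm (Z.1 - Z.2))%:E | Z in A `*` A])%E.

(* Equal to the L^oo norm for a function that is continuous on a compact set
   which is the closure of its interior, such as a grounded cylinder. *)
Definition Linfty_norm (A : set 'rV[R]_n) (u : 'rV[R]_n -> R) : R :=
  sup [set `|u X| | X in A].

Definition partial (i : 'I_n) (u : 'rV[R]_n -> R) : 'rV[R]_n -> R :=
  fun X => 'D_(delta_mx 0 i) u X.

Definition laplacian (u : 'rV[R]_n -> R) X : R :=
  \sum_(i < n) partial i (partial i u) X.

(* [A] is meant to be open. *)
Definition C2_on (A : set 'rV[R]_n) (u : 'rV[R]_n -> R) : Prop :=
  forall X, A X ->
  [/\ {for X, continuous u},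
      forall i, derivable u X (delta_mx 0 i) /\
                {for X, continuous (partial i u)} &
      forall i j, derivable (partial i u) X (delta_mx 0 j) /\
                  {for X, continuous (partial j (partial i u))}].

Definition cone (Sigma : set 'rV[R]_n) : set 'rV[R]_n :=
  [set X | exists t Y, [/\ 0 < t, Sigma Y & X = t *: Y]].

Definition spherical_domain (Sigma : set 'rV[R]_n) : Prop :=
  [/\ Sigma !=set0,
      exists O : set 'rV[R]_n, open O /\ Sigma = sphere `&` O &
      connected Sigma].

(* As the sphere is closed and [Sigma] is relatively open, this is the boundary
   of [Sigma] in the sphere. *)
Definition sph_boundary (Sigma : set 'rV[R]_n) : set 'rV[R]_n :=
  closure Sigma `\` Sigma.

(* Near each boundary point [p], orthogonal projection to the tangent
   hyperplane at [p] is a chart of the sphere; in this chart [Sigma] is the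
   region strictly above the graph of a Lipschitz function, [e] being the
   vertical direction. The argument of [h] only ranges over the orthogonal
   complement of [p] and [e]. *)
Definition lipschitz_boundary (Sigma : set 'rV[R]_n) : Prop :=
  forall p, sph_boundary Sigma p ->
  exists (e : 'rV[R]_n) (h : 'rV[R]_n -> R) (r : R),
    [/\ enorm e = 1, dot e p = 0, lipschitz_fun h, 0 < r &
        forall theta, sphere theta -> enorm (theta - p) < r ->
          (Sigma theta <->
           h (theta - dot theta e *: e - dot theta p *: p) < dot theta e)].

Definition radial_ext (E : 'rV[R]_n -> R) : 'rV[R]_n -> R :=
  fun X => E ((enorm X)^-1 *: X).

(* The Laplace-Beltrami operator of the unit sphere is the restriction to the
   sphere of the Laplacian of the 0-homogeneous extension. *)
Definition sph_laplacian (E : 'rV[R]_n -> R) theta : R :=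
  laplacian (radial_ext E) theta.

(* Classical eigenfunctions; [E] is C^2 on [Sigma] iff its 0-homogeneous
   extension is C^2 on the cone. *)
Definition dirichlet_eigenfunction (Sigma : set 'rV[R]_n) (mu : R)
    (E : 'rV[R]_n -> R) : Prop :=
  [/\ C2_on (cone Sigma) (radial_ext E),
      {within closure Sigma, continuous E},
      forall theta, sph_boundary Sigma theta -> E theta = 0,
      exists2 theta, Sigma theta & E theta != 0 &
      forall theta, Sigma theta -> - sph_laplacian E theta = mu * E theta].

Definition dirichlet_eigenvalue (Sigma : set 'rV[R]_n) (mu : R) : Prop :=
  exists E, dirichlet_eigenfunction Sigma mu E.

Definition first_dirichlet_eigenvalue (Sigma : set 'rV[R]_n) (mu : R) : Prop :=
  dirichlet_eigenvalue Sigma mu /\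
  forall nu, dirichlet_eigenvalue Sigma nu -> mu <= nu.

Definition frequency (Sigma : set 'rV[R]_n) (phi : R) : Prop :=
  0 < phi /\
  exists2 mu, first_dirichlet_eigenvalue Sigma mu &
              phi * (n%:R + phi - 2) = mu.

Definition first_dirichlet_eigenfunction (Sigma : set 'rV[R]_n)
    (E : 'rV[R]_n -> R) : Prop :=
  [/\ exists2 mu, first_dirichlet_eigenvalue Sigma mu &
                  dirichlet_eigenfunction Sigma mu E,
      forall theta, Sigma theta -> 0 < E theta <= 1 &
      exists2 theta, Sigma theta & E theta = 1].

Definition homogeneous_ext (phi : R) (E : 'rV[R]_n -> R) : 'rV[R]_n -> R :=
  fun X => enorm X `^ phi * radial_ext E X.

(* [A] is meant to be open, so that [closure A `\` A] is its boundary. *)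
Definition dirichlet_solution (A : set 'rV[R]_n) (rhs w : 'rV[R]_n -> R) :
    Prop :=
  [/\ {within closure A, continuous w}, C2_on A w,
      forall X, A X -> - laplacian w X = rhs X &
      forall X, (closure A `\` A) X -> w X = 0].

End EuclideanSpace.

Section GroundedCylinder.
Context {R : realType} {m : nat}.
Implicit Types (X : 'rV[R]_m.+1) (g : 'rV[R]_m -> R) (r : R).

Definition horiz X : 'rV[R]_m := col' ord_max X.
Definition vert X : R := X 0 ord_max.

Definition graph g : set 'rV[R]_m.+1 := [set X | vert X = g (horiz X)].

Definition grounded_cylinder g r : set 'rV[R]_m.+1 :=
  [set Y | enorm (horiz Y) <= r /\ 0 <= vert Y - g (horiz Y) <= r].

(* Classical nonnegative solutions. The equation is imposed in the interior of
   the closed set [grounded_cylinder g r]. There [u] has to be positive for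
   [u ^ (- gamma)] to be meaningful ([powR] has the junk value 0 at 0). *)
Definition singular_solution (gamma : R) (f : 'rV[R]_m.+1 -> R) g r
    (u : 'rV[R]_m.+1 -> R) : Prop :=
  let GC := grounded_cylinder g r in
  [/\ {within GC, continuous u} /\ C2_on GC° u,
      forall X, GC X -> 0 <= u X,
      forall X, GC° X -> 0 < u X,
      forall X, GC° X -> - laplacian u X = f X * u X `^ (- gamma) &
      forall X, (graph g `&` GC) X -> u X = 0].

End GroundedCylinder.

(* Main.v *)
Require Import Defs.
From HB Require Import structures.
From mathcomp Require Import all_boot all_order all_algebra.
From mathcomp Require Import all_classical all_reals all_analysis.
From mathcomp Require Import ring lra.
Import Order.TTheory GRing.Theory Num.Theory.
Import numFieldNormedType.Exports.
Local Open Scope classical_set_scope.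
Local Open Scope ring_scope.
Set Implicit Arguments.
Unset Strict Implicit.
Unset Printing Implicit Defensive.

(** Write [H] for the homogeneous harmonic function [homogeneous_ext phi E], put
    [a = 1 / (1 + gamma)], so that [phi = 2 * a], and let [w] solve
    [- Delta w = H ^ (- gamma)] in the unit ball of the cone. Three ideas give
    the bound.

    A supersolution. The geometric mean [S = H ^ (1 - a) * w ^ a] satisfies
    [- Delta S >= a * S ^ (- gamma)]: being concave and homogeneous in [(H, w)],
    it lies below its tangent linear combination of [H] and [w]
    ([geo_mean_tangent]), whose Laplacian is known, and
    [S ^ (1 + gamma) = w * H ^ gamma]. A large multiple [k * S] is then a
    supersolution of the equation of [u], and [u - k * S] is subharmonic where
    it is positive ([singular_growth]).

    Decay at the vertex. A function that is subharmonic where positive, bounded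
    by [M] in the ball of radius [r0] and nonpositive on the lateral boundary
    of the cone, is at most a constant times [M * (|X| / r0) ^ phi]
    ([cone_decay]). The usual argument is the boundary Harnack inequality; here
    [w] serves as the barrier. Its equation has a right-hand side that blows
    up at the lateral boundary, so the function
    [C * H (X / r) + eta * w (X / r) + |X / r| ^ 2] is strictly superharmonic
    wherever it is below 1 ([growth_barrier]). As [phi < 2], comparison with it
    improves a bound [A * H + B] by more than the factor [s ^ phi] in [B] when
    the radius shrinks by [s], and the constants [A] stay bounded under
    iteration.

    The logarithm. In the critical case [H ^ (- gamma)] is homogeneous of
    degree [phi - 2], and [w - s ^ phi * w (X / s)] is harmonic. By the decay
    estimate it is of order [|X| ^ phi]; summing over the scales between [|X|]
    and 1 gives [w <= C * |X| ^ phi * (1 + ln (1 / |X|))] ([critical_growth]).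
    Hence [S] is of order [|X| ^ phi * (1 + ln (1 / |X|)) ^ a], and [a = phi / 2].

    All comparisons rest on [maximum_principle], which only differentiates
    functions touching from below. To apply them to [u], the interior of the
    grounded cylinder is shown to lie in the cone, not only in its closure
    ([interior_closure_cone]); the term [k * S] is absorbed into a multiple of
    the supremum of [u] by a lower bound for the latter
    ([singular_solution_lower_bound]). At points away from the origin the claim
    only says that [u] is at most a multiple of its supremum, because the
    logarithm is bounded below for [|X| <= rho < 2 * rad]. *)

(** * Second order calculus along coordinate lines *)

Section Line.
Context {R : realType} {V : normedModType R}.
Implicit Types (v : V -> R) (X e : V) (t d : R).

Lemma line_growth v X e t :
  (fun h : R => h^-1 *: (v ((h *: (1 : R) + t) *: e + X) - v (t *: e + X))) =
  (fun h : R => h^-1 *: (v (h *: e + (t *: e + X)) - v (t *: e + X))).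
Proof.
by apply/funext => h; rewrite [h *: 1]mulr1 scalerDl addrA.
Qed.

Lemma is_derive_line v X e t d :
  is_derive (t *: e + X) e v d -> is_derive t 1 (fun s => v (s *: e + X)) d.
Proof.
by move=> [dv <-]; split; rewrite /derivable /derive line_growth.
Qed.

Lemma derive_line v X e t :
  'D_1 (fun s : R => v (s *: e + X)) t = 'D_e v (t *: e + X).
Proof. by rewrite /derive line_growth. Qed.

Lemma derivable_line v X e t :
  derivable v (t *: e + X) e -> derivable (fun s : R => v (s *: e + X)) t 1.
Proof. by rewrite /derivable line_growth. Qed.

Lemma near_line (P : set V) X e :
  nbhs X P -> \forall t \near (0 : R), P (t *: e + X).
Proof.
move=> nP; have : (fun t : R => t *: e + X) @ (0 : R) --> X.
  rewrite -[X in _ --> X]add0r -[X in _ --> X + _](scale0r e).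
  by apply: cvgD; [apply: cvgZr_tmp; exact: cvg_id | exact: cvg_cst].
by move=> /(_ _ nP).
Qed.

End Line.

Lemma second_derivative_at_max {R : realType} (f : R -> R) :
  (\forall t \near (0 : R), derivable f t 1) ->
  derivable (fun t => 'D_1 f t) 0 1 ->
  (\forall t \near (0 : R), f t <= f 0) -> 'D_1 (fun t => 'D_1 f t) 0 <= 0.
Proof.
move=> df d2f fmax; rewrite leNgt; apply/negP => d2_gt0.
have : \forall t \near (0 : R), derivable f t 1 /\ f t <= f 0 by exact: filterI.
move=> /(@nbhs_norm0P R R^o)[r /= r0 rP].
have inr t : t \in `]-r, r[ -> derivable f t 1 /\ f t <= f 0.
  rewrite in_itv/= => /andP[t1 t2]; apply: rP.
  by rewrite /= ltr_norml t1.
have f'0 : 'D_1 f 0 = 0.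
  apply: derive_val; apply: (@derive1_at_max _ _ (- r) r).
  - by rewrite -subr_ge0 opprK addr_ge0 ?ltW.
  - by move=> t /inr[].
  - by rewrite in_itv/= oppr_lt0 r0.
  - by move=> t /inr[].
have : \forall h \near (0:R)^', 0 < h^-1 *: ('D_1 f (h *: (1:R) + 0) - 'D_1 f 0).
  exact: (cvgr_gt _ d2f).
rewrite near_withinE => /(@nbhs_norm0P R R^o)[q /= q0 qP].
(* On ]0, h] the derivative is positive, so the mean value theorem makes
   [f h] larger than [f 0]. *)
pose h := Num.min r q / 2.
have mrq : 0 < Num.min r q by rewrite lt_min r0.
have h0 : 0 < h by rewrite divr_gt0.
have hm : h < Num.min r q by rewrite /h ltr_pdivrMr// ltr_pMr// ltr1n.
have /andP[hr hq] : (h < r) && (h < q) by rewrite -lt_min.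
have itv t : t \in `]0, h[ -> t \in `]-r, r[.
  rewrite !in_itv/= => /andP[t1 t2]; rewrite (lt_trans t2 hr) andbT.
  by rewrite (lt_trans _ t1)// oppr_lt0.
have h_in : h \in `]-r, r[ by rewrite in_itv/= hr (lt_trans _ h0)// oppr_lt0.
have [c c_in Dfc] : exists2 c, c \in `]0, h[ & f h - f 0 = 'D_1 f c * (h - 0).
  apply: (MVT h0) => [t /itv/inr[ft _]|]; first exact: derivableP.
  apply: derivable_within_continuous => t; rewrite in_itv/= => /andP[t0 th].
  apply: (inr _ _).1; rewrite in_itv/= (le_lt_trans th hr) andbT.
  by rewrite (lt_le_trans _ t0)// oppr_lt0.
have [_ fh] := inr _ h_in.
move: c_in; rewrite in_itv/= => /andP[c0 ch].
have : 0 < c^-1 *: ('D_1 f (c *: (1:R) + 0) - 'D_1 f 0).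
  apply: qP; last by rewrite gt_eqF.
  by rewrite /= gtr0_norm// (lt_trans ch).
rewrite f'0 subr0 [c *: 1]mulr1 addr0 [_ *: _]mulrC pmulr_lgt0 ?invr_gt0// => fc0.
move: fh; rewrite -subr_le0 Dfc subr0 leNgt mulr_gt0//.
Qed.

Section Laplacian.
Context {R : realType} {n : nat}.
Local Notation V := 'rV[R]_n.
Local Notation "''e_' i" := (delta_mx 0 i : V).
Implicit Types (v w : V -> R) (X Y : V) (a b c : R).

(** Only the pure second derivatives enter, and only at one point: this is
    the least regularity that the second derivative test at a maximum needs,
    and it passes to linear combinations and dilations. *)
Definition is_lap v X a : Prop :=
  [/\ \forall Y \near X, forall i, derivable v Y (delta_mx 0 i),
      forall i, derivable (partial i v) X (delta_mx 0 i) &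
      laplacian v X = a].

Lemma C2_is_lap (A : set V) v X :
  open A -> C2_on A v -> A X -> is_lap v X (laplacian v X).
Proof.
move=> oA vA AX; split => //.
- near=> Y => i.
  have /vA[_ + _] : A Y by near: Y; exact: open_nbhs_nbhs.
  by move=> /(_ i)[].
- by move=> i; have [_ _ /(_ i i)[]] := vA _ AX.
Unshelve. all: by end_near. Qed.

Lemma is_lapD v w X a b :
  is_lap v X a -> is_lap w X b -> is_lap (fun Y => v Y + w Y) X (a + b).
Proof.
move=> [v1 v2 <-] [w1 w2 <-].
have D : \forall Y \near X, forall i,
    partial i v Y + partial i w Y = partial i (fun Y => v Y + w Y) Y.
  by apply: filterS2 v1 w1 => Y vY wY i; rewrite /partial -deriveD.
have Di i : \forall Y \near X,
    partial i v Y + partial i w Y = partial i (fun Y => v Y + w Y) Y.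
  by apply: filterS D => Y /(_ i).
split.
- by apply: filterS2 v1 w1 => Y vY wY i; exact: derivableD.
- by move=> i; apply: near_eq_derivable (Di i) _; exact: derivableD.
- rewrite /laplacian -big_split/=; apply: eq_bigr => i _.
  rewrite {1}/partial -(near_eq_derive _ (Di i)).
  exact: deriveD.
Qed.

Lemma is_lapZ c v X a :
  is_lap v X a -> is_lap (fun Y => c * v Y) X (c * a).
Proof.
move=> [v1 v2 <-].
have Z : \forall Y \near X, forall i,
    c * partial i v Y = partial i (fun Y => c * v Y) Y.
  near=> Y => i; rewrite /partial -[RHS]/('D_('e_ i) (c \*: v) Y) deriveZ//.
  by move: i; near: Y.
have Zi i : \forall Y \near X, c * partial i v Y = partial i (fun Y => c * v Y) Y.
  by apply: filterS Z => Y /(_ i).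
split.
- near=> Y => i; apply: (@derivableZ _ _ _ v c).
  by move: i; near: Y.
- move=> i; apply: near_eq_derivable (Zi i) _.
  exact: (@derivableZ _ _ _ (partial i v) c).
- rewrite /laplacian mulr_sumr; apply: eq_bigr => i _.
  rewrite {1}/partial -(near_eq_derive _ (Zi i)).
  by rewrite -[LHS]/('D_('e_ i) (c \*: partial i v) X) deriveZ.
Unshelve. all: by end_near. Qed.

Lemma is_lap_cst c X : is_lap (fun=> c) X 0.
Proof.
have D i : partial i (fun=> c) = (fun=> 0 : R).
  by apply/funext => Y; exact: derive_cst.
split; first by near=> Y => i; exact: derivable_cst.
  by move=> i; rewrite D; exact: derivable_cst.
by rewrite /laplacian big1// => i _; rewrite D; exact: derive_cst.
Unshelve. all: by end_near. Qed.

Lemma is_lapB v w X a b :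
  is_lap v X a -> is_lap w X b -> is_lap (fun Y => v Y - w Y) X (a - b).
Proof.
move=> va /(is_lapZ (-1)) wb; rewrite -mulN1r.
rewrite (_ : (fun Y => v Y - w Y) = (fun Y => v Y + -1 * w Y)).
  exact: is_lapD.
by apply/funext => Y; rewrite mulN1r.
Qed.

Lemma lap_at_max v X a :
  is_lap v X a -> (\forall Y \near X, v Y <= v X) -> a <= 0.
Proof.
move=> [v1 v2 <-] vmax; apply: sumr_le0 => i _.
have -> : partial i (partial i v) X =
    'D_1 (fun t => 'D_1 (fun s : R => v (s *: 'e_ i + X)) t) 0.
  under eq_fun do rewrite derive_line.
  by rewrite (derive_line (partial i v)) scale0r add0r.
apply: second_derivative_at_max.
- have lX : \forall t \near (0 : R), derivable v (t *: 'e_ i + X) ('e_ i).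
    have vi : \forall Y \near X, derivable v Y ('e_ i).
      by move: v1; apply: filterS => Y /(_ i).
    exact: (@near_line _ _ (fun Y => derivable v Y ('e_ i))).
  by move: lX; apply: filterS => t; exact: derivable_line.
- under eq_fun do rewrite derive_line.
  by apply: (derivable_line (v := partial i v)); rewrite scale0r add0r.
- rewrite scale0r add0r.
  exact: (@near_line _ _ (fun Y => v Y <= v X)).
Qed.

End Laplacian.

Lemma eq_is_derive {R : realType} {V : normedModType R} (v w : V -> R) X e d d' :
  v =1 w -> d = d' -> is_derive X e v d -> is_derive X e w d'.
Proof. by move=> /funext -> ->. Qed.

Section Directions.
Context {R : realType} {V : normedModType R}.
Implicit Types (v : V -> R) (X e : V) (t c d : R).

Lemma is_derive_line0 v X e d :
  is_derive X e v d <-> is_derive (0:R) (1:R) (fun s : R => v (s *: e + X)) d.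
Proof.
have E := line_growth v X e 0; rewrite scale0r add0r in E.
by split=> -[dv <-]; split; move: dv; rewrite /derivable /derive scale0r add0r E.
Qed.

(** Going through the line [s |-> v (s *: e + X)] avoids the total
    differentiability that a chain rule in several variables would need. *)
Lemma is_derive_dirZ v X e d c :
  is_derive X e v d -> is_derive X (c *: e) v (c * d).
Proof.
move=> /is_derive_line0 Dv; apply/is_derive_line0.
have -> : (fun s : R => v (s *: (c *: e) + X)) =
    (fun s : R => v (s *: e + X)) \o (fun s : R => s * c).
  by apply/funext => s /=; rewrite scalerA.
have Dm : is_derive (0 : R) (1 : R) (fun s : R => s * c) c.
  have := is_deriveM (is_derive_id (0:R) 1) (is_derive_cst c (0:R) 1).
  by apply: eq_is_derive => //; rewrite scaler0 add0r [_ *: _]mulr1.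
apply: (is_derive_eq (is_derive1_comp _ Dm)).
  by rewrite mul0r; exact: Dv.
by rewrite mulrC.
Qed.

Lemma is_derive_chain (g : R -> R) v X e d d' :
  is_derive X e v d -> is_derive (v X) 1 g d' ->
  is_derive X e (fun Y => g (v Y)) (d * d').
Proof.
move=> /is_derive_line0 Dv Dg; apply/is_derive_line0.
rewrite -[fun s => g _]/(g \o (fun s : R => v (s *: e + X))).
apply: (is_derive_eq (is_derive1_comp _ Dv)).
  by rewrite scale0r add0r; exact: Dg.
by rewrite mulrC.
Qed.

Lemma is_derive_dilation v X e d c :
  is_derive (c *: X) e v d -> is_derive X e (fun Y => v (c *: Y)) (c * d).
Proof.
move=> /(is_derive_dirZ c) /is_derive_line0 Dv; apply/is_derive_line0.
suff -> : (fun s : R => v (c *: (s *: e + X))) =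
          (fun s : R => v (s *: (c *: e) + c *: X)) by [].
by apply/funext => s; rewrite scalerDr !scalerA mulrC.
Qed.

Lemma near_dilation (P : set V) X c :
  nbhs (c *: X) P -> \forall Y \near X, P (c *: Y).
Proof.
have : (fun Y : V => c *: Y) @ X --> c *: X.
  by apply: cvgZl_tmp; exact: cvg_id.
by move=> /(_ P) /[apply].
Qed.

End Directions.

Section MoreLaplacian.
Context {R : realType} {n : nat}.
Local Notation V := 'rV[R]_n.
Local Notation "''e_' i" := (delta_mx 0 i : V).
Implicit Types (v w : V -> R) (X Y : V) (a b c : R).

Lemma is_lap_dilation v X a c :
  is_lap v (c *: X) a -> is_lap (fun Y => v (c *: Y)) X (c ^+ 2 * a).
Proof.
move=> [v1 v2 <-].
have v1' : \forall Y \near X, forall i, derivable v (c *: Y) 'e_i.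
  by apply: (@near_dilation _ _ (fun Y => forall i, derivable v Y 'e_i)).
have D : \forall Y \near X, forall i,
    c * partial i v (c *: Y) = partial i (fun Y => v (c *: Y)) Y.
  apply: filterS v1' => Y vY i.
  have /derivableP/is_derive_dilation := vY i.
  by move=> /@derive_val <-.
have Di i : \forall Y \near X,
    c * partial i v (c *: Y) = partial i (fun Y => v (c *: Y)) Y.
  by apply: filterS D => Y /(_ i).
have D2 i : is_derive X 'e_i (partial i (fun Y => v (c *: Y)))
    (c * (c * partial i (partial i v) (c *: X))).
  apply: near_eq_is_derive (Di i) _.
  have /derivableP/is_derive_dilation Dv := v2 i.
  exact: (is_deriveZ c).
split.
- apply: filterS v1' => Y vY i.
  by have /derivableP/is_derive_dilation[] := vY i.
- by move=> i; have [] := D2 i.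
- rewrite /laplacian mulr_sumr; apply: eq_bigr => i _.
  by rewrite expr2 -mulrA; have [_ D2E] := D2 i; exact: D2E.
Qed.

Lemma is_lapM v w X a b :
  is_lap v X a -> is_lap w X b ->
  is_lap (fun Y => v Y * w Y) X
    (v X * b + 2 * (\sum_(i < n) partial i v X * partial i w X) + a * w X).
Proof.
move=> [v1 v2 <-] [w1 w2 <-].
have D : \forall Y \near X, forall i,
    v Y * partial i w Y + w Y * partial i v Y = partial i (fun Y => v Y * w Y) Y.
  apply: filterS2 v1 w1 => Y vY wY i.
  by rewrite /partial -[RHS]/('D_('e_i) (v * w) Y) deriveM.
have Di i : \forall Y \near X,
    v Y * partial i w Y + w Y * partial i v Y = partial i (fun Y => v Y * w Y) Y.
  by apply: filterS D => Y /(_ i).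
have D2 i : is_derive X 'e_i (partial i (fun Y => v Y * w Y))
   (v X * partial i (partial i w) X + 2 * (partial i v X * partial i w X)
    + partial i (partial i v) X * w X).
  apply: near_eq_is_derive (Di i) _.
  have vX : derivable v X 'e_i by exact: (nbhs_singleton v1).
  have wX : derivable w X 'e_i by exact: (nbhs_singleton w1).
  have := is_deriveD (is_deriveM (derivableP vX) (derivableP (w2 i)))
                     (is_deriveM (derivableP wX) (derivableP (v2 i))).
  apply: eq_is_derive => //.
  change (v X * partial i (partial i w) X + partial i w X * partial i v X +
    (w X * partial i (partial i v) X + partial i v X * partial i w X) =
    v X * partial i (partial i w) X + 2 * (partial i v X * partial i w X)
    + partial i (partial i v) X * w X).
  move: (v X) (w X) (partial i v X) (partial i w X) (partial i (partial i v) X)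
    (partial i (partial i w) X) => *; ring.
split.
- by apply: filterS2 v1 w1 => Y vY wY i; exact: derivableM.
- by move=> i; have [] := D2 i.
- rewrite /laplacian mulr_suml mulr_sumr mulr_sumr -!big_split/=.
  by apply: eq_bigr => i _; have [_ D2E] := D2 i; exact: D2E.
Qed.

Lemma is_derive_coord X (i j : 'I_n) :
  is_derive X 'e_i (fun Y : V => Y 0 j) (i == j)%:R.
Proof.
apply/is_derive_line0.
have -> : (fun s : R => (s *: 'e_i + X) 0 j) =
    (fun s : R => s * (i == j)%:R + X 0 j).
  by apply/funext => s; rewrite !mxE eqxx/= eq_sym.
have := is_deriveD (is_deriveM (is_derive_id (0:R) 1)
   (is_derive_cst ((i == j)%:R : R) (0:R) 1)) (is_derive_cst (X 0 j) (0:R) 1).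
by apply: eq_is_derive => //; rewrite addr0 scaler0 add0r [_ *: _]mulr1.
Qed.

Lemma is_derive_coordB X Z (i j : 'I_n) :
  is_derive X 'e_i (fun Y : V => (Y - Z) 0 j) (i == j)%:R.
Proof.
have -> : (fun Y : V => (Y - Z) 0 j) = (fun Y : V => Y 0 j + (- Z) 0 j).
  by apply/funext => Y; rewrite mxE.
have := is_deriveD (is_derive_coord X i j) (is_derive_cst ((- Z) 0 j) X 'e_i).
by apply: eq_is_derive => //; rewrite addr0.
Qed.

Lemma is_derive_dist2 X Z (i : 'I_n) :
  is_derive X 'e_i (fun Y : V => dot (Y - Z) (Y - Z)) (2 * (X - Z) 0 i).
Proof.
have -> : (fun Y : V => dot (Y - Z) (Y - Z)) =
    \sum_(j < n) (fun Y : V => (Y - Z) 0 j * (Y - Z) 0 j).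
  by apply/funext => Y; rewrite fct_sumE.
have := is_derive_sum (fun j => is_deriveM (is_derive_coordB X Z i j)
  (is_derive_coordB X Z i j)).
apply: eq_is_derive => //; rewrite (bigD1 i)//= eqxx big1 => [|j ji].
  by rewrite addr0 [_ *: _]mulr1 -mulr2n mulr_natl.
by rewrite eq_sym (negPf ji) !scaler0 addr0.
Qed.

Lemma is_lap_dist2 X Z :
  is_lap (fun Y : V => dot (Y - Z) (Y - Z)) X (2 * n%:R).
Proof.
have E i : partial i (fun Y : V => dot (Y - Z) (Y - Z)) =
    (fun Y => 2 * (Y - Z) 0 i).
  apply/funext => Y; rewrite /partial.
  by have [_ ->] := is_derive_dist2 Y Z i.
have D2 i : is_derive X 'e_i (fun Y => 2 * (Y - Z) 0 i) 2.
  have := is_deriveZ (2:R) (is_derive_coordB X Z i i).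
  by apply: eq_is_derive => //; rewrite eqxx [_ *: _]mulr1.
split.
- by near=> Y => i; have [] := is_derive_dist2 Y Z i.
- by move=> i; rewrite E; have [] := D2 i.
- rewrite /laplacian (eq_bigr (fun=> 2)) => [|i _].
    by rewrite sumr_const card_ord mulr_natr.
  by rewrite E /partial; have [_ ->] := D2 i.
Unshelve. all: by end_near. Qed.

End MoreLaplacian.

(** * The Euclidean norm *)

Section EuclideanNorm.
Context {R : realType} {n : nat}.
Local Notation V := 'rV[R]_n.
Implicit Types (X Y Z p e : V) (A : set V) (c : R).

Lemma dot_ge0 X : 0 <= dot X X.
Proof. by apply: sumr_ge0 => i _; rewrite -expr2 sqr_ge0. Qed.

Lemma enorm_ge0 X : 0 <= enorm X.
Proof. exact: sqrtr_ge0. Qed.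

Lemma sqr_enorm X : enorm X ^+ 2 = dot X X.
Proof. by rewrite sqr_sqrtr// dot_ge0. Qed.

Lemma enormZ c X : enorm (c *: X) = `|c| * enorm X.
Proof.
rewrite /enorm -sqrtr_sqr -sqrtrM ?sqr_ge0//; congr Num.sqrt.
by rewrite /dot mulr_sumr; apply: eq_bigr => i _; rewrite !mxE; ring.
Qed.

Lemma enormZ_ge0 c X : 0 <= c -> enorm (c *: X) = c * enorm X.
Proof. by move=> c0; rewrite enormZ ger0_norm. Qed.

Lemma enorm0 : enorm (0 : V) = 0.
Proof. by rewrite -(scale0r 0) enormZ normr0 mul0r. Qed.

Lemma coord_le_enorm X i : `|X 0 i| <= enorm X.
Proof.
rewrite -(@ler_pXn2r _ 2)// ?nnegrE ?enorm_ge0// sqr_enorm real_normK ?num_real//.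
rewrite /dot (bigD1 i)//= -expr2 lerDl.
by apply: sumr_ge0 => j _; rewrite -expr2 sqr_ge0.
Qed.

Lemma enorm_eq0 X : (enorm X == 0) = (X == 0).
Proof.
apply/eqP/eqP => [X0|->]; last exact: enorm0.
apply/rowP => i; rewrite mxE; apply/eqP; rewrite -normr_le0 -X0.
exact: coord_le_enorm.
Qed.

Lemma enorm_gt0 X : (0 < enorm X) = (X != 0).
Proof. by rewrite lt_neqAle enorm_ge0 andbT eq_sym enorm_eq0. Qed.

(** Compares with the max norm that defines boundedness and the topology. *)
Lemma norm_le_enorm X : `|X| <= enorm X.
Proof.
rewrite -[leLHS]/(mx_norm X) mx_normrE.
apply/bigmax_leP; split => [|[i j] _ /=]; first exact: enorm_ge0.
by rewrite ord1 coord_le_enorm.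
Qed.

Lemma dot_continuous : continuous (fun X : V => dot X X).
Proof.
have -> : (fun X : V => dot X X) = \sum_(i < n) (fun X : V => X 0 i * X 0 i).
  by apply/funext => Y; rewrite fct_sumE.
move=> X; apply: differentiable_continuous; apply: differentiable_sum => i.
by apply: differentiableM; exact: differentiable_coord.
Qed.

Lemma enorm_continuous : continuous (enorm : V -> R).
Proof.
move=> X; apply: continuous_comp; first exact: dot_continuous.
exact: sqrt_continuous.
Qed.

Lemma enorm_powR X c : enorm X `^ c = dot X X `^ (c / 2).
Proof. by rewrite /enorm -powR12_sqrt ?dot_ge0// -powRrM mulrC. Qed.

Lemma enorm_normalize X : X != 0 -> enorm ((enorm X)^-1 *: X) = 1.
Proof.
by rewrite -enorm_gt0 => X0; rewrite enormZ_ge0 ?invr_ge0 ?ltW// mulVf ?gt_eqF.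
Qed.

Lemma enormB_continuous p : continuous (fun Y : V => enorm (Y - p)).
Proof.
move=> Y; have cp : {for Y, continuous (fun _ : V => p)} by exact: cst_continuous.
have cB : {for Y, continuous (fun Z : V => Z - p)}.
  exact: (continuousB (@cvg_id _ (nbhs Y)) cp).
exact: (continuous_comp cB (@enorm_continuous _)).
Qed.

Lemma enormN X : enorm (- X) = enorm X :> R.
Proof. by rewrite -scaleN1r enormZ normrN1 mul1r. Qed.

Lemma dotDl X Y Z : dot (X + Y) Z = dot X Z + dot Y Z :> R.
Proof. by rewrite /dot -big_split/=; apply: eq_bigr => i _; rewrite mxE mulrDl. Qed.

Lemma dotZl (c : R) X Z : dot (c *: X) Z = c * dot X Z :> R.
Proof. by rewrite /dot mulr_sumr; apply: eq_bigr => i _; rewrite mxE mulrA. Qed.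

Lemma dotC X Y : dot X Y = dot Y X :> R.
Proof. by rewrite /dot; apply: eq_bigr => i _; rewrite mulrC. Qed.

Lemma dotl_continuous e : continuous (fun X : V => dot X e).
Proof.
have -> : (fun X : V => dot X e) = \sum_(i < n) (fun X : V => X 0 i * e 0 i).
  by apply/funext => Y; rewrite fct_sumE.
move=> X; apply: differentiable_continuous; apply: differentiable_sum => i.
have di : differentiable (fun X : V => X 0 i) X by exact: differentiable_coord.
exact: (differentiableM di (differentiable_cst (e 0 i) X)).
Qed.

Lemma open_eball (r : R) :
  open (eball r : set V).
Proof.
rewrite openE => Y Yr; suff : \forall Z \near Y, enorm Z < r by [].
exact: (cvgr_lt _ (@enorm_continuous Y)).
Qed.

Lemma closure_enorm_le A (M : R) p :
  (forall X, A X -> enorm X <= M) -> closure A p -> enorm p <= M.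
Proof.
move=> bA clp; rewrite leNgt; apply/negP => Mp.
have : \forall X \near p, M < enorm X by exact: (cvgr_gt _ (@enorm_continuous p)).
by move=> /clp[X [/bA XM /=]]; rewrite ltNge XM.
Qed.

Lemma bounded_enorm A (M : R) : (forall X, A X -> enorm X <= M) -> bounded_set A.
Proof.
move=> bA; exists M; split; first exact: num_real.
move=> N MN X /bA XM /=.
by rewrite (le_trans (norm_le_enorm X))// (le_trans XM)// ltW.
Qed.

End EuclideanNorm.

(** * Homogeneous harmonic functions in a cone *)

Section Euler.
Context {R : realType} {n : nat}.
Local Notation V := 'rV[R]_n.
Local Notation "''e_' i" := (delta_mx 0 i : V).
Implicit Types (v : V -> R) (X Y : V).

(** Differentiability from continuous partial derivatives: the increment along
    the sum of the directions in [s] is split into one coordinate step for each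
    element of [s], and each step is a mean value at a point that tends to
    [X]. *)
Lemma C1_increment v X (d : 'I_n -> R) (s : seq 'I_n) (eps : R) :
  (\forall Y \near X, forall i, derivable v Y 'e_i) ->
  (forall i, {for X, continuous (partial i v)}) ->
  0 < eps ->
  \forall h \near (0 : R),
    `|v (h *: (\sum_(j <- s) d j *: 'e_j) + X) - v X
      - h * (\sum_(j <- s) d j * partial j v X)| <= eps * `|h|.
Proof.
move=> v1 cv; elim: s eps => [|j s IHs] eps eps0.
  near=> h; rewrite !big_nil scaler0 add0r mulr0 !subrr normr0.
  by rewrite mulr_ge0// ltW.
set S := \sum_(i <- s) _ in IHs *.
pose eps' := eps / 2 / (`|d j| + 1).
have dj0 : 0 < `|d j| + 1 by rewrite ltr_wpDl.
have eps'0 : 0 < eps' by rewrite !divr_gt0.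
have cvj : \forall Z \near X, `|partial j v X - partial j v Z| <= eps'.
  by move/cvgrPdist_le : (cv j) => /(_ _ eps'0).
have : \forall Z \near X, derivable v Z 'e_j /\
    `|partial j v X - partial j v Z| <= eps'.
  by apply: filterS2 v1 cvj => Z /(_ j).
move=> /nbhs_normP[r /= r0 rP].
pose K := `|d j| * `|'e_j| + `|S|.
have K0 : 0 <= K by rewrite addr_ge0// mulr_ge0.
have hr : \forall h \near (0 : R), `|h| < r / (K + 1).
  have rK : 0 < r / (K + 1) by rewrite divr_gt0// ltr_wpDl.
  by apply: (@nbhs0_lt _ _ _ rK).
have e2 : 0 < eps / 2 by rewrite divr_gt0.
apply: filterS2 hr (IHs _ e2) => h hr IH.
pose Y := h *: S + X.
have inball (t : R) : 0 <= t <= 1 -> `|X - (t *: ((h * d j) *: 'e_j) + Y)| < r.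
  move=> /andP[t0 t1].
  rewrite /Y addrA opprD addrCA subrr addr0 normrN.
  apply: (le_lt_trans (ler_normD _ _)). rewrite !normrZ (ger0_norm t0).
  have hK : `|h| * K < r.
    rewrite (@le_lt_trans _ _ (`|h| * (K + 1)))// ?ler_wpM2l ?lerDl//.
    by rewrite -ltr_pdivlMr// ltr_wpDl.
  apply: le_lt_trans hK; rewrite /K mulrDr lerD2r !mulrA.
  by rewrite -!mulrA ler_piMl// !mulr_ge0.
have dY (t : R) : 0 <= t <= 1 ->
    is_derive t 1 (fun t => v (t *: ((h * d j) *: 'e_j) + Y))
      (h * d j * partial j v (t *: ((h * d j) *: 'e_j) + Y)).
  move=> /inball/rP[dv _]; apply: is_derive_line; apply: is_derive_dirZ.
  exact: derivableP.
have [t /andP[t0 t1] E] : exists2 t : R, 0 <= t <= 1 &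
    v ((h * d j) *: 'e_j + Y) - v Y =
    h * d j * partial j v (t *: ((h * d j) *: 'e_j) + Y).
  have [|||t] := @MVT_segment _ (fun t => v (t *: ((h * d j) *: 'e_j) + Y))
      (fun t => h * d j * partial j v (t *: ((h * d j) *: 'e_j) + Y)) 0 1.
  - exact: ler01.
  - by move=> t; rewrite in_itv/= => /andP[t0 t1]; apply: dY; rewrite !ltW.
  - apply: derivable_within_continuous => t; rewrite in_itv/= => t01.
    by have [] := dY _ t01.
  - rewrite in_itv/= => t01; rewrite scale1r scale0r add0r subr0 mulr1 => E.
    by exists t.
have [_ close] : derivable v (t *: ((h * d j) *: 'e_j) + Y) 'e_j /\
    `|partial j v X - partial j v (t *: ((h * d j) *: 'e_j) + Y)| <= eps'.
  by apply: rP; apply: inball; rewrite t0.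
rewrite !big_cons -/S.
have -> : h *: (d j *: 'e_j + S) + X = (h * d j) *: 'e_j + Y.
  by rewrite scalerDr scalerA -addrA.
rewrite -(subrK (v Y) (v ((h * d j) *: 'e_j + Y))) E.
set p := partial j v (_ + Y) in close *.
set T := \sum_(i <- s) _ in IH *.
have -> : h * d j * p + v Y - v X - h * (d j * partial j v X + T) =
  (v Y - v X - h * T) - (h * d j) * (partial j v X - p) by ring.
apply: (le_trans (ler_normB _ _)).
have -> : eps * `|h| = eps / 2 * `|h| + eps / 2 * `|h| by field.
apply: lerD; first exact: IH.
rewrite !normrM -mulrA [leRHS]mulrC ler_wpM2l//.
apply: (@le_trans _ _ (`|d j| * eps')); first by rewrite ler_wpM2l.
rewrite /eps' mulrCA ger_pMr// ler_pdivrMr// mul1r lerDl//.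
Unshelve. all: by end_near. Qed.

(** Euler's relation in degree 0: [v] is constant on the ray through [X], so
    its increment in the direction [X] vanishes. *)
Lemma euler_homogeneous0 v X :
  (\forall Y \near X, forall i, derivable v Y 'e_i) ->
  (forall i, {for X, continuous (partial i v)}) ->
  (forall c, 0 < c -> v (c *: X) = v X) ->
  \sum_(i < n) X 0 i * partial i v X = 0.
Proof.
move=> v1 cv hom; apply/eqP; rewrite -normr_le0; apply/ler_addgt0Pl => eps eps0.
rewrite addr0.
have := C1_increment (fun i => X 0 i) (index_enum 'I_n) v1 cv eps0.
have -> : \sum_(j < n) X 0 j *: 'e_j = X by rewrite -row_sum_delta.
move=> inc.
have [r r0 rP] : exists2 r : R, 0 < r & forall h : R, `|h| < r ->
    `|v (h *: X + X) - v X - h * (\sum_(j < n) X 0 j * partial j v X)|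
      <= eps * `|h|.
  by move/(@nbhs_norm0P R R^o) : inc => -[r /= r0 rP]; exists r.
have h0 : 0 < r / 2 by rewrite divr_gt0.
have := rP (r / 2).
rewrite gtr0_norm// ltr_pdivrMr// ltr_pMr// ltr1n => /(_ isT).
rewrite -[X in _ *: X + X]scale1r -[X in _ *: _ + X]scale1r.
rewrite scale1r -scalerDl hom ?addr_gt0// subrr sub0r normrN normrM gtr0_norm//.
by rewrite mulrC ler_pM2r.
Qed.

End Euler.

Section RadialPower.
Context {R : realType} {n : nat}.
Local Notation V := 'rV[R]_n.
Local Notation "''e_' i" := (delta_mx 0 i : V).
Implicit Types (X Y : V) (b : R).

Lemma near_neq0 X : X != 0 -> \forall Y \near X, Y != 0.
Proof.
rewrite -enorm_gt0 => X0; near=> Y; rewrite -enorm_gt0.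
near: Y; exact: (cvgr_gt _ (@enorm_continuous R n X)).
Unshelve. all: by end_near. Qed.

Lemma dot_gt0 X : (0 < dot X X) = (X != 0).
Proof. by rewrite -sqr_enorm exprn_even_gt0//= enorm_eq0. Qed.

Lemma is_derive_dotpow X i b : X != 0 ->
  is_derive X 'e_i (fun Y : V => dot Y Y `^ b)
    (2 * b * (dot X X `^ (b - 1) * X 0 i)).
Proof.
move=> X0.
have D : is_derive X 'e_i (fun Y : V => dot Y Y) (2 * X 0 i).
  apply: eq_is_derive (is_derive_dist2 X 0 i) => [Y|]; by rewrite subr0.
have P : is_derive (dot X X) (1 : R) (fun x : R => x `^ b) (b * dot X X `^ (b - 1)).
  by apply: is_derive1_powR; rewrite dot_gt0.
apply: eq_is_derive (is_derive_chain D P) => //.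
by ring.
Qed.

(** With [2 * b = phi] the constant is [phi * (n + phi - 2)], the eigenvalue
    attached to the frequency [phi]. *)
Lemma is_lap_dotpow X b : X != 0 ->
  is_lap (fun Y : V => dot Y Y `^ b) X
    (2 * b * (n%:R + 2 * b - 2) * dot X X `^ (b - 1)).
Proof.
move=> X0.
have D : \forall Y \near X, forall i,
    2 * b * (dot Y Y `^ (b - 1) * Y 0 i) =
    partial i (fun Y : V => dot Y Y `^ b) Y.
  apply: filterS (near_neq0 X0) => Y Y0 i.
  by have [_ E] := is_derive_dotpow i b Y0; rewrite -E.
have D2 i : is_derive X 'e_i (partial i (fun Y : V => dot Y Y `^ b))
    (2 * b * (dot X X `^ (b - 1) + 2 * (b - 1) *
      (dot X X `^ (b - 1 - 1) * (X 0 i * X 0 i)))).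
  have Di : \forall Y \near X,
      2 * b * (dot Y Y `^ (b - 1) * Y 0 i) =
      partial i (fun Y : V => dot Y Y `^ b) Y.
    by apply: filterS D => Y /(_ i).
  apply: near_eq_is_derive Di _.
  have := is_deriveZ (2 * b) (is_deriveM (is_derive_dotpow i (b - 1) X0)
    (is_derive_coord X i i)).
  apply: eq_is_derive => //; rewrite eqxx.
  rewrite -![_ *: _]/(_ * _) mulr1; congr (_ * (_ + _)).
  by move: (X 0 i) (dot X X `^ _) => *; ring.
split.
- apply: filterS (near_neq0 X0) => Y Y0 i.
  by have [] := is_derive_dotpow i b Y0.
- by move=> i; have [] := D2 i.
- rewrite /laplacian.
  transitivity (\sum_(i < n) (2 * b * (dot X X `^ (b - 1) + 2 * (b - 1) *
      (dot X X `^ (b - 1 - 1) * (X 0 i * X 0 i))))).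
    by apply: eq_bigr => i _; have [_ E] := D2 i; exact: E.
  rewrite -mulr_sumr -[RHS]mulrA; congr (_ * _).
  rewrite big_split/= sumr_const card_ord -!mulr_sumr -/(dot X X).
  have -> : dot X X `^ (b - 1 - 1) * dot X X = dot X X `^ (b - 1).
    have q0 : 0 < dot X X by rewrite dot_gt0.
    rewrite -[X in _ * X](powRr1 (ltW q0)) -powRD ?subrK//.
    by apply/implyP => _; rewrite gt_eqF.
  by rewrite -mulr_natr; ring.
Unshelve. all: by end_near. Qed.

End RadialPower.

Section Cone.
Context {R : realType} {n : nat}.
Local Notation V := 'rV[R]_n.
Local Notation "''e_' i" := (delta_mx 0 i : V).
Implicit Types (X Y : V) (c : R) (Sigma : set V) (E : V -> R).

Lemma cone_neq0 Sigma X : Sigma `<=` sphere -> cone Sigma X -> X != 0.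
Proof.
move=> sph [t [Y [t0 /sph Y1 ->]]]; rewrite scaler_eq0 gt_eqF//=.
by rewrite -enorm_eq0 (_ : enorm Y = 1)// oner_eq0.
Qed.

Lemma coneP Sigma X : Sigma `<=` sphere -> X != 0 ->
  cone Sigma X <-> Sigma ((enorm X)^-1 *: X).
Proof.
move=> sph X0; split => [[t [Y [t0 SY ->]]]|SX].
  rewrite enormZ_ge0 ?ltW// (sph _ SY) mulr1.
  by rewrite scalerA mulVf ?gt_eqF// scale1r.
exists (enorm X), ((enorm X)^-1 *: X); rewrite enorm_gt0; split => //.
by rewrite scalerA divff ?scale1r// enorm_eq0.
Qed.

Lemma coneZ Sigma X c : 0 < c -> cone Sigma X -> cone Sigma (c *: X).
Proof.
move=> c0 [t [Y [t0 SY ->]]]; exists (c * t), Y.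
by rewrite scalerA mulr_gt0.
Qed.

Lemma normalize_continuous X : X != 0 ->
  {for X, continuous (fun Y : V => (enorm Y)^-1 *: Y)}.
Proof.
rewrite -enorm_eq0 => X0.
have ce : {for X, continuous (fun Y : V => (enorm Y)^-1)}.
  exact: (continuousV X0 (@enorm_continuous R n X)).
exact: (continuousZ ce (@cvg_id _ (nbhs X))).
Qed.

Lemma open_cone Sigma O : open O -> Sigma = sphere `&` O -> open (cone Sigma).
Proof.
move=> oO SE; have sph : Sigma `<=` sphere by rewrite SE; exact: subIsetl.
rewrite openE => X cX; have X0 := cone_neq0 sph cX.
have O_X : nbhs ((enorm X)^-1 *: X) O.
  move/(coneP sph X0) : cX; rewrite SE => -[_ OX].
  exact: open_nbhs_nbhs.
have nO : \forall Y \near X, O ((enorm Y)^-1 *: Y).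
  exact: (normalize_continuous X0 O_X).
suff : \forall Y \near X, cone Sigma Y by [].
apply: filterS2 nO (near_neq0 X0) => Y OY Y0.
apply/(coneP sph Y0); rewrite SE; split => //.
exact: enorm_normalize.
Qed.

Lemma radial_extZ E X c : 0 < c -> radial_ext E (c *: X) = radial_ext E X.
Proof.
move=> c0; rewrite /radial_ext enormZ_ge0 ?ltW// invfM scalerA.
by rewrite mulrAC mulVf ?mul1r// gt_eqF.
Qed.

Lemma homogeneous_extZ (p : R) E X c : 0 < c ->
  homogeneous_ext p E (c *: X) = c `^ p * homogeneous_ext p E X.
Proof.
move=> c0; rewrite /homogeneous_ext radial_extZ// enormZ_ge0 ?ltW//.
by rewrite powRM ?enorm_ge0 ?ltW// mulrA.
Qed.

Lemma homogeneous_ext_gt0 (p : R) Sigma E X : Sigma `<=` sphere ->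
  (forall theta, Sigma theta -> 0 < E theta) ->
  cone Sigma X -> 0 < homogeneous_ext p E X.
Proof.
move=> sph E0 cX; have X0 := cone_neq0 sph cX.
rewrite mulr_gt0 ?powR_gt0 ?enorm_gt0//.
by apply: E0; apply/(coneP sph X0).
Qed.

Lemma homogeneous_ext_le (p : R) Sigma E X : Sigma `<=` sphere ->
  (forall theta, Sigma theta -> E theta <= 1) ->
  cone Sigma X -> homogeneous_ext p E X <= enorm X `^ p.
Proof.
move=> sph E0 cX; have X0 := cone_neq0 sph cX.
rewrite ler_piMr ?powR_ge0//.
by apply: E0; apply/(coneP sph X0).
Qed.

(** In the product of the radial power and the 0-homogeneous function, the
    mixed term vanishes by Euler's relation, and the two remaining terms cancel
    because the eigenvalue is [p * (n + p - 2)]. *)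
Lemma homogeneous_ext_harmonic (p mu : R) Sigma O E X :
  open O -> Sigma = sphere `&` O -> p * (n%:R + p - 2) = mu ->
  C2_on (cone Sigma) (radial_ext E) ->
  (forall theta, Sigma theta -> - sph_laplacian E theta = mu * E theta) ->
  cone Sigma X -> is_lap (homogeneous_ext p E) X 0.
Proof.
move=> oO SE muE E2 eig cX.
have sph : Sigma `<=` sphere by rewrite SE; exact: subIsetl.
have X0 := cone_neq0 sph cX.
have oC : open (cone Sigma) by exact: open_cone SE.
pose theta := (enorm X)^-1 *: X.
have St : Sigma theta by exact/(coneP sph X0).
have c0 : 0 < (enorm X)^-1 by rewrite invr_gt0 enorm_gt0.
have lapF : is_lap (radial_ext E) X
    ((enorm X)^-1 ^+ 2 * - (mu * radial_ext E X)).
  have -> : radial_ext E = (fun Y => radial_ext E ((enorm X)^-1 *: Y)).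
    by apply/funext => Y; rewrite radial_extZ.
  apply: is_lap_dilation; rewrite radial_extZ// -(eig _ St) opprK.
  by apply: (C2_is_lap oC) => //; exact: coneZ.
have [F1 F2 _] := lapF.
have -> : homogeneous_ext p E =
    (fun Y => dot Y Y `^ (p / 2) * radial_ext E Y).
  by apply/funext => Y; rewrite /homogeneous_ext enorm_powR.
have := is_lapM (is_lap_dotpow (p / 2) X0) lapF.
have -> : \sum_(i < n) partial i (fun Y : V => dot Y Y `^ (p / 2)) X *
    partial i (radial_ext E) X = 0.
  transitivity (2 * (p / 2) * (dot X X `^ (p / 2 - 1)) *
      \sum_(i < n) X 0 i * partial i (radial_ext E) X).
    rewrite mulr_sumr; apply: eq_bigr => i _.
    have [_ DE] := is_derive_dotpow i (p / 2) X0.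
    by rewrite {1}/partial DE !mulrA.
  rewrite euler_homogeneous0 ?mulr0//.
  - by move=> i; have [_ /(_ i)[_ +] _] := E2 _ cX.
  - by move=> c cpos; rewrite radial_extZ.
congr (is_lap _ _ _).
have q0 : 0 < dot X X by rewrite dot_gt0.
have -> : (enorm X)^-1 ^+ 2 = (dot X X)^-1 by rewrite exprVn sqr_enorm.
rewrite powRB; last by apply/implyP => _; rewrite gt_eqF.
rewrite powRr1 ?ltW// -muE.
by field; rewrite gt_eqF.
Qed.

Lemma homogeneous_ext_continuous (p : R) Sigma E X : Sigma `<=` sphere ->
  C2_on (cone Sigma) (radial_ext E) -> cone Sigma X ->
  {for X, continuous (homogeneous_ext p E)}.
Proof.
move=> sph E2 cX; have X0 := cone_neq0 sph cX.
have -> : homogeneous_ext p E =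
    (fun Y => dot Y Y `^ (p / 2) * radial_ext E Y).
  by apply/funext => Y; rewrite /homogeneous_ext enorm_powR.
have cpow : {for dot X X, continuous (fun x : R => x `^ (p / 2))}.
  apply: differentiable_continuous; apply/derivable1_diffP.
  by apply: ex_derive; apply: is_derive1_powR; rewrite dot_gt0.
have cdot := continuous_comp (@dot_continuous R n X) cpow.
have cE : {for X, continuous (radial_ext E)} by have [] := E2 _ cX.
exact: (continuousM cdot cE).
Qed.

End Cone.

(** * Maximum principle *)

Section MaximumPrinciple.
Context {R : realType} {n : nat}.
Local Notation V := 'rV[R]_n.
Implicit Types (X Y p : V) (D : set V) (v z q : V -> R).

(** If [v] took a positive value, it would attain its maximum in [D]; a function
    [q] touching [v] from below there has a local maximum too, which contradicts
    a positive Laplacian of [q]. Since only [q] is differentiated, [v] may be a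
    smooth function minus a minimum of smooth ones. *)
Lemma maximum_principle D v (M : R) :
  open D -> (forall X, D X -> enorm X <= M) ->
  (forall X, D X -> {for X, continuous v}) ->
  (forall p, closure D p -> ~ D p -> forall eps : R, 0 < eps ->
     \forall X \near p, D X -> v X < eps) ->
  (forall X, D X -> 0 < v X -> exists q l,
     [/\ is_lap q X l, 0 < l, q X = v X & \forall Y \near X, q Y <= v Y]) ->
  forall X, D X -> v X <= 0.
Proof.
move=> oD bD cv bdry touch X1 DX1; rewrite leNgt; apply/negP => v1.
pose eps := v X1 / 2.
have eps0 : 0 < eps by rewrite divr_gt0.
pose F : set V := [set X | D X /\ eps <= v X].
have F0 : F !=set0.
  by exists X1; split=> //; rewrite /eps ler_pdivrMr// ler_peMr ?ler1n// ltW.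
have cF : closed F.
  move=> p clFp.
  have clDp : closure D p by apply: closureS clFp => Y [].
  have [Dp|nDp] := pselect (D p).
    split=> //; rewrite leNgt; apply/negP => vp.
    have : \forall X \near p, v X < eps by exact: (cvgr_lt _ (cv _ Dp)).
    by move=> /clFp[Y [[DY vY] /=]]; rewrite ltNge vY.
  have /clFp[Y [[DY vY] /= /(_ DY)]] := bdry _ clDp nDp _ eps0.
  by rewrite ltNge vY.
have bF : bounded_set F.
  exists M; split; first exact: num_real.
  move=> N MN X [DX _] /=.
  by rewrite (le_trans (norm_le_enorm X))// (le_trans (bD _ DX))// ltW.
have cvF : {within F, continuous v}.
  by apply: continuous_in_subspaceT => X /set_mem[DX _]; exact: cv.
have [c cF' cmax] := EVT_max_rV F0 (bounded_closed_compact bF cF) cvF.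
have [Dc vc] := set_mem cF'.
have maxD Y : D Y -> v Y <= v c.
  move=> DY; have [vY|vY] := leP eps (v Y).
    by apply: cmax; apply/mem_set.
  exact: (le_trans (ltW vY)).
have vc0 : 0 < v c by exact: lt_le_trans vc.
have [q [l [lapq l0 qc qv]]] := touch _ Dc vc0.
suff : l <= 0 by rewrite leNgt l0.
apply: (lap_at_max lapq).
apply: filterS2 qv (open_nbhs_nbhs (conj oD Dc)) => Y qY DY.
by rewrite qc (le_trans qY)// maxD.
Qed.

(** Viscosity form of subharmonicity of the positive part of [z]. *)
Definition subharmonic_where_pos D z : Prop :=
  forall X, D X -> 0 < z X -> exists q l,
    [/\ is_lap q X l, 0 <= l, q X = z X & \forall Y \near X, q Y <= z Y].

(** For a domain cut out of a cone by a ball of radius at least [r], the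
    boundary points considered are the lateral ones and the vertex. *)
Definition nonpos_on_boundary D (r : R) z : Prop :=
  forall p, closure D p -> ~ D p -> enorm p < r -> forall eps : R, 0 < eps ->
    \forall X \near p, D X -> z X < eps.

End MaximumPrinciple.

Section Dyadic.
Context {R : realType}.
Implicit Types s x : R.

Lemma geometric_scale s x : 0 < s < 1 -> 0 < x < 1 ->
  exists j : nat, s ^+ j.+1 <= x < s ^+ j.
Proof.
move=> /andP[s0 s1] /andP[x0 x1].
have ex : exists j, s ^+ j <= x.
  have s1' : `|s| < 1 by rewrite gtr0_norm.
  have /cvgrPdist_le/(_ x x0)[N _ NP] := cvg_expr s1'.
  exists N; have := NP N (leqnn N).
  by rewrite /= sub0r normrN ger0_norm ?exprn_ge0 // ltW.
case: (ex_minnP ex) => -[|j] jx jmin; first by rewrite expr0 leNgt x1 in jx.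
exists j; rewrite jx /= ltNge; apply/negP => /jmin.
by rewrite ltnn.
Qed.

End Dyadic.

(** * Growth near the vertex of a critical cone *)

Section GeometricMean.
Context {R : realType}.
Implicit Types a x y : R.

(** [x ^ (1 - a) * y ^ a], in exponential form. *)
Definition geo_mean a x y : R := expR ((1 - a) * ln x + a * ln y).

Lemma expR_convex a x y : 0 <= a <= 1 ->
  expR ((1 - a) * x + a * y) <= (1 - a) * expR x + a * expR y.
Proof.
move=> /andP[a0 a1]; set m := _ + a * y.
have tangent t : expR m * (1 + (t - m)) <= expR t.
  have -> : expR t = expR (t - m) * expR m by rewrite -expRD subrK.
  rewrite [leLHS]mulrC ler_pM2r ?expR_gt0//.
  exact: expR_ge1Dx.
have a1' : 0 <= 1 - a by rewrite subr_ge0.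
apply: le_trans (lerD (ler_wpM2l a1' (tangent x)) (ler_wpM2l a0 (tangent y))).
by rewrite le_eqVlt; apply/orP; left; apply/eqP; rewrite /m; ring.
Qed.

(** The geometric mean is concave and homogeneous of degree 1, so it lies
    below the linear function tangent to it at [(x0, y0)]. *)
Lemma geo_mean_tangent a x y x0 y0 : 0 <= a <= 1 ->
  0 < x -> 0 < y -> 0 < x0 -> 0 < y0 ->
  geo_mean a x y <= geo_mean a x0 y0 * ((1 - a) / x0) * x
                    + geo_mean a x0 y0 * (a / y0) * y.
Proof.
move=> a01 x_gt0 y_gt0 x0_gt0 y0_gt0; set S := geo_mean a x0 y0.
have [s sE] : exists s, s = (1 - a) * ln x0 + a * ln y0 by eexists.
have SE : S = expR s by rewrite sE.
have := expR_convex (s + (ln x - ln x0)) (s + (ln y - ln y0)) a01.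
have eS t t0 : 0 < t -> 0 < t0 -> expR (s + (ln t - ln t0)) = S * (t / t0).
  by move=> t_gt0 t0_gt0; rewrite !expRD expRN !lnK ?posrE// -SE.
rewrite !eS//.
have -> : (1 - a) * (s + (ln x - ln x0)) + a * (s + (ln y - ln y0)) =
    (1 - a) * ln x + a * ln y by rewrite sE; ring.
rewrite -/(geo_mean a x y) => /le_trans; apply.
rewrite le_eqVlt; apply/orP; left; apply/eqP; field.
by rewrite !gt_eqF.
Qed.

Lemma geo_mean_le a x y h b : 0 <= a <= 1 ->
  0 < x -> 0 < y -> x <= h -> y <= b * h -> 0 < b ->
  geo_mean a x y <= b `^ a * h.
Proof.
move=> /andP[a0 a1] x0 y0 xh yh b0.
have h0 : 0 < h by exact: lt_le_trans xh.
have -> : b `^ a * h = expR (a * ln b + ln h).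
  by rewrite expRD lnK ?posrE// /powR gt_eqF.
rewrite ler_expR.
have lx : ln x <= ln h by rewrite ler_ln.
have ly : ln y <= ln b + ln h by rewrite -lnM// ler_ln ?posrE ?mulr_gt0.
have a1' : 0 <= 1 - a by rewrite subr_ge0.
have := ler_wpM2l a1' lx; have := ler_wpM2l a0 ly.
by move: (ln x) (ln y) (ln h) (ln b) => *; lra.
Qed.

End GeometricMean.

(** The first term carries the logarithm that the singular right-hand side
    forces in the critical case; the second one is the influence of the values
    of [u] away from the vertex. The constants are uniform in [f], [u] and the
    domain. *)
Definition critical_growth_bound {R : realType} {n : nat} (K : set 'rV[R]_n)
    (phi gamma : R) : Prop :=
  exists C K0 : R, [/\ 0 < C, 0 < K0 &
  forall Lam D (f u : 'rV[R]_n -> R) (r0 M : R), 0 < Lam ->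
    open D -> D `<=` K `&` eball 1 ->
    (forall X, D X -> {for X, continuous u}) ->
    (forall X, D X -> 0 < u X) ->
    (forall X, D X -> f X <= Lam) ->
    (forall X, D X -> is_lap u X (- (f X * u X `^ (- gamma)))) ->
    nonpos_on_boundary D r0 u ->
    0 < r0 -> 0 < M -> (forall X, D X -> enorm X < r0 -> u X <= M) ->
    forall X, D X -> enorm X < r0 ->
      u X <= (1 + Lam * (1 + gamma)) *
               (C * (1 + ln (enorm X)^-1)) `^ (1 + gamma)^-1 * enorm X `^ phi
             + K0 * M * (enorm X / r0) `^ phi].

Section Growth.
Context {R : realType} {n : nat}.
Local Notation V := 'rV[R]_n.
Implicit Types (X Y p : V) (D : set V) (z q : V -> R).

(** [K] is the cone, [H] its homogeneous harmonic function and [w] the solution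
    of [- Delta w = H ^ (- gamma)] in the unit ball of the cone. *)
Variables (K : set V) (H w : V -> R) (phi gamma W : R).
Hypothesis gamma_gt0 : 0 < gamma.
Hypothesis phi_gt0 : 0 < phi.
Hypothesis phi_lt2 : phi < 2.
Hypothesis W_gt0 : 0 < W.
Hypothesis K_dilation : forall X c, 0 < c -> K X -> K (c *: X).
Hypothesis K_neq0 : forall X, K X -> X != 0.
Hypothesis H_gt0 : forall X, K X -> 0 < H X.
Hypothesis H_le : forall X, K X -> H X <= enorm X `^ phi.
Hypothesis H_cont : forall X, K X -> {for X, continuous H}.
Hypothesis H_lap : forall X, K X -> is_lap H X 0.
Hypothesis H_dilation : forall X c, 0 < c -> H (c *: X) = c `^ phi * H X.
Hypothesis w_bound : forall X, K X -> enorm X < 1 -> 0 <= w X <= W.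
Hypothesis w_cont : forall X, K X -> enorm X < 1 -> {for X, continuous w}.
Hypothesis w_lap : forall X, K X -> enorm X < 1 ->
  is_lap w X (- (H X `^ (- gamma))).

(** The barrier is superharmonic where it matters. On the ball of radius [r]
    the last term, which dominates [z] on the sphere, has Laplacian
    [2 * n / r ^ 2]; the singular right-hand side of the equation of [w]
    compensates it wherever [H (X / r)] is small, in particular near the
    lateral boundary. Where [H (X / r) >= 1 / C], the barrier already exceeds
    the given bound for [z]. *)
Lemma growth_barrier D z (r A B C eta : R) :
  open D -> D `<=` K -> (forall X, D X -> {for X, continuous z}) ->
  subharmonic_where_pos D z -> nonpos_on_boundary D r z ->
  0 < r -> 0 <= A -> 0 < B -> 0 < C -> 0 < eta ->
  2 * n%:R <= eta * C `^ gamma ->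
  (forall X, D X -> enorm X < r -> z X <= A * H X + B) ->
  forall X, D X -> enorm X < r ->
    z X <= A * H X + B * (C * H (r^-1 *: X) + eta * w (r^-1 *: X)
                          + r^-1 ^+ 2 * dot X X).
Proof.
move=> oD DK cz subz latz r0 A0 B0 C0 eta0 etaC zAB X0 DX0 X0r.
pose b X := A * H X + B * (C * H (r^-1 *: X) + eta * w (r^-1 *: X)
                          + r^-1 ^+ 2 * dot X X).
have rV0 : 0 < r^-1 by rewrite invr_gt0.
have KV X : D X -> K (r^-1 *: X) by move=> /DK; exact: K_dilation.
have V1 X : enorm X < r -> enorm (r^-1 *: X) < 1.
  by move=> Xr; rewrite enormZ_ge0 1?ltW// mulrC ltr_pdivrMr// mul1r.
have quad0 X : 0 <= r^-1 ^+ 2 * dot X X by rewrite mulr_ge0 ?sqr_ge0 ?dot_ge0.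
have w0 X : D X -> enorm X < r -> 0 <= eta * w (r^-1 *: X).
  move=> DX Xr; rewrite mulr_ge0 ?(ltW eta0)//.
  by have /andP[] := w_bound (KV _ DX) (V1 _ Xr).
have AH0 X : D X -> 0 <= A * H X by move=> /DK KX; rewrite mulr_ge0 ?(ltW (H_gt0 KX)).
have CH0 X : D X -> 0 <= C * H (r^-1 *: X).
  by move=> /KV KX; rewrite mulr_ge0 ?(ltW C0) ?(ltW (H_gt0 KX)).
have b0 X : D X -> enorm X < r -> 0 <= b X.
  move=> DX Xr; by rewrite addr_ge0 ?AH0// mulr_ge0 ?(ltW B0)// !addr_ge0 ?w0 ?CH0.
have oD' : open (D `&` eball r) by apply: openI => //; exact: open_eball.
suff : z X0 - b X0 <= 0 by rewrite subr_le0.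
apply: (@maximum_principle _ _ (D `&` eball r) (fun X => z X - b X) r oD') => //.
- by move=> X [_ /ltW].
- move=> X [DX Xr].
  have cdil : {for X, continuous (fun Y : V => r^-1 *: Y)}.
    by move=> U /near_dilation.
  have cH : {for X, continuous (fun Y => H (r^-1 *: Y))}.
    by apply: (continuous_comp cdil); exact: H_cont (KV _ DX).
  have cw : {for X, continuous (fun Y => w (r^-1 *: Y))}.
    by apply: (continuous_comp cdil); exact: w_cont (KV _ DX) (V1 _ Xr).
  have cst c : {for X, continuous (fun _ : V => c : R)} by exact: cst_continuous.
  have cb : {for X, continuous b}.
    apply: continuousD.
      exact: continuousM (cst A) (H_cont (DK _ DX)).
    apply: (continuousM (cst B)); apply: continuousD.
      exact: (continuousD (continuousM (cst C) cH) (continuousM (cst eta) cw)).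
    exact: (continuousM (cst _) (@dot_continuous R n X)).
  exact: (continuousB (cz _ DX) cb).
- move=> p clp nDp eps eps0.
  have [pr|rp] := ltP (enorm p) r.
    have clDp : closure D p by apply: closureS clp => Y [].
    have nDp' : ~ D p by move=> Dp; apply: nDp.
    have := latz p clDp nDp' pr eps eps0.
    apply: filterS => Y zY [DY Yr].
    by rewrite (le_lt_trans _ (zY DY))// gerBl b0.
  have cq : {for p, continuous (fun Y : V => B - B * (r^-1 ^+ 2 * dot Y Y))}.
    have cst c : {for p, continuous (fun _ : V => c : R)} by exact: cst_continuous.
    apply: (continuousB (cst B)); apply: (continuousM (cst B)).
    exact: (continuousM (cst _) (@dot_continuous R n p)).
  have : \forall Y \near p, B - B * (r^-1 ^+ 2 * dot Y Y) < eps.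
    apply: (cvgr_lt _ cq); apply: le_lt_trans eps0.
    rewrite subr_le0 ler_peMr ?(ltW B0)// -sqr_enorm -exprMn mulrC.
    by rewrite exprn_ege1// ler_pdivlMr// mul1r.
  apply: filterS => Y qY [DY Yr]; apply: le_lt_trans qY.
  rewrite /b opprD addrA lerB//; first by rewrite lerBlDl zAB.
  by rewrite ler_pM2l// lerDr addr_ge0 ?w0 ?CH0.
- move=> X [DX Xr] v0.
  have zX0 : 0 < z X.
    by rewrite (le_lt_trans (b0 _ DX Xr))// -subr_gt0.
  have [q [l [lapq l0 qz qle]]] := subz _ DX zX0.
  have small : C * H (r^-1 *: X) < 1.
    rewrite ltNge; apply/negP => Hbig; move: v0; rewrite ltNge => /negP; apply.
    rewrite subr_le0 (le_trans (zAB _ DX Xr))// /b lerD2l ler_peMr ?(ltW B0)//.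
    by rewrite -addrA (le_trans Hbig)// lerDl addr_ge0 ?w0.
  have Hpos := H_gt0 (KV _ DX).
  have big : 2 * n%:R < eta * H (r^-1 *: X) `^ (- gamma).
    apply: (le_lt_trans etaC); rewrite ltr_pM2l// powRN -powR_inv1 ?powR_ge0//.
    rewrite -powRrM mulrC powRrM powR_inv1 1?ltW//.
    rewrite gt0_ltr_powR// ?nnegrE ?invr_ge0 1?ltW//.
    by rewrite -[ltRHS]mul1r ltr_pdivlMr.
  exists (fun Y => q Y - b Y), (l - (A * 0 + B * (C * (r^-1 ^+ 2 * 0) +
     eta * (r^-1 ^+ 2 * - (H (r^-1 *: X) `^ (- gamma))) +
     r^-1 ^+ 2 * (2 * n%:R)))); split.
  + apply: is_lapB => //; apply: is_lapD; first exact/is_lapZ/H_lap/DK.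
    apply: is_lapZ; apply: is_lapD; last first.
      apply: is_lapZ.
      have -> : (fun Y : V => dot Y Y) = (fun Y => dot (Y - 0) (Y - 0)).
        by apply/funext => Y; rewrite subr0.
      exact: is_lap_dist2.
    apply: is_lapD; apply: is_lapZ; apply: is_lap_dilation.
      exact/H_lap/KV.
    by apply: w_lap; [exact: KV | exact: V1].
  + rewrite subr_gt0 (lt_le_trans _ l0)// !mulr0 !add0r pmulr_rlt0//.
    have -> : eta * (r^-1 ^+ 2 * - H (r^-1 *: X) `^ (- gamma)) +
        r^-1 ^+ 2 * (2 * n%:R) =
      r^-1 ^+ 2 * (2 * n%:R - eta * H (r^-1 *: X) `^ (- gamma)) by ring.
    by rewrite pmulr_rlt0 ?exprn_gt0// subr_lt0.
  + by rewrite qz.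
  + by apply: filterS qle => Y qY; rewrite lerB.
Qed.

Lemma powR_exprn (s p : R) j : 0 <= s -> (s ^+ j) `^ p = (s `^ p) ^+ j.
Proof.
move=> s0; elim: j => [|j IH]; first by rewrite !expr0 powR1.
by rewrite !exprS powRM ?exprn_ge0// IH.
Qed.

(** This is where [phi < 2] enters. *)
Lemma exists_scale : exists s : R, 0 < s < 1 /\ s ^+ 2 <= s `^ phi / 4.
Proof.
have e0 : 0 < 2 - phi by rewrite subr_gt0.
pose s : R := 4^-1 `^ (2 - phi)^-1.
have s0 : 0 < s by rewrite powR_gt0.
exists s; split.
  have one : (1 : R) = 1 `^ (2 - phi)^-1 by rewrite powR1.
  rewrite s0 one gt0_ltr_powR ?invr_gt0 ?nnegrE ?ler01 ?invr_ge0//=.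
  by rewrite invf_lt1// ltr1n.
have -> : s ^+ 2 = s `^ phi * s `^ (2 - phi).
  rewrite -powRD ?subrKC ?powR_mulrn ?ltW//.
  by rewrite gt_eqF ?implybT.
by rewrite /s -[in X in _ * X]powRrM mulVf ?gt_eqF// powRr1 ?invr_ge0.
Qed.

(** A substitute for the boundary Harnack inequality. A bound [A * H + B] in
    the ball of radius [r] improves by the barrier to [A' * H + s ^ phi / 2 * B]
    in the ball of radius [s * r]. At the scale [s ^ j * r0] the constant is
    [B = M * (s ^ phi / 2) ^ j], smaller than [(s ^ j) ^ phi * M] by the factor
    [2 ^ j], so the increments [A' - A], of order [B / (s ^ j * r0) ^ phi], form
    a convergent geometric series. *)
Lemma cone_decay : exists2 C0 : R, 0 < C0 &
  forall D z (r0 M : R), open D -> D `<=` K ->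
    (forall X, D X -> {for X, continuous z}) ->
    subharmonic_where_pos D z -> nonpos_on_boundary D r0 z ->
    0 < r0 -> 0 < M -> (forall X, D X -> enorm X < r0 -> z X <= M) ->
    forall X, D X -> enorm X < r0 -> z X <= C0 * M * (enorm X / r0) `^ phi.
Proof.
have [s [/andP[s0 s1] s2]] := exists_scale.
pose d := s `^ phi.
have d0 : 0 < d by rewrite powR_gt0.
(* [eta * w <= d / 4], and [s ^ 2 <= d / 4] bounds the quadratic term: the
   remainder after one step is at most [d / 2]. *)
pose eta := d / (4 * W).
have eta0 : 0 < eta by rewrite divr_gt0// mulr_gt0.
(* The barrier asks for [2 * n <= eta * C ^ gamma]; [n.+1] keeps [C] positive. *)
pose C := (2 * n.+1%:R / eta) `^ gamma^-1.
have C0 : 0 < C by rewrite powR_gt0// divr_gt0// mulr_gt0.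
have etaC : 2 * n%:R <= eta * C `^ gamma.
  have q0 : 0 <= 2 * n.+1%:R / eta by apply: divr_ge0; [exact: mulr_ge0 | exact: ltW].
  rewrite /C -powRrM mulVf ?gt_eqF// (powRr1 q0).
  by rewrite [leRHS]mulrC divfK ?gt_eqF// ler_pM2l// ler_nat.
exists (2 * C + d^-1); first by rewrite addr_gt0 ?mulr_gt0 ?invr_gt0.
move=> D z r0 M oD DK cz subz latz r00 M0 zM.
pose A j := 2 * C * M * r0^-1 `^ phi * (1 - 2^-1 ^+ j).
pose B j := M * (d / 2) ^+ j.
have rj0 j : 0 < s ^+ j * r0 by rewrite mulr_gt0 ?exprn_gt0.
have half1 j : (2^-1 : R) ^+ j <= 1.
  by rewrite exprn_ile1 ?invr_ge0 ?ler0n// invf_le1// ler1n.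
have A0 j : 0 <= A j.
  rewrite /A !mulr_ge0 ?powR_ge0 ?(ltW C0) ?(ltW M0) ?subr_ge0 ?half1//.
have B0 j : 0 < B j by rewrite /B mulr_gt0 ?exprn_gt0 ?divr_gt0.
have step j : forall X, D X -> enorm X < s ^+ j * r0 -> z X <= A j * H X + B j.
  elim: j => [X DX|j IH X DX Xr].
    rewrite /A /B !expr0 subrr mulr0 mul0r add0r mul1r mulr1; exact: zM.
  have rjr0 : s ^+ j * r0 <= r0.
    by rewrite ler_piMl ?(ltW r00)// exprn_ile1 ?ltW.
  have latj : nonpos_on_boundary D (s ^+ j * r0) z.
    by move=> p cp np pr; apply: latz => //; exact: lt_le_trans rjr0.
  have Xr' : enorm X < s ^+ j * r0.
    apply: lt_trans Xr _; rewrite ltr_pM2r// exprS gtr_pMl// exprn_gt0//.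
  have := growth_barrier oD DK cz subz latj (rj0 j) (A0 j) (B0 j) C0 eta0 etaC IH DX Xr'.
  move=> /le_trans; apply.
  set r := s ^+ j * r0 in Xr' rj0 *.
  have rV0 : 0 < r^-1 by rewrite invr_gt0 rj0.
  have KX := DK _ DX.
  have /andP[_ wW] : 0 <= w (r^-1 *: X) <= W.
    apply: w_bound; first exact: K_dilation.
    by rewrite enormZ_ge0 1?ltW// mulrC ltr_pdivrMr ?rj0// mul1r.
  have quad : r^-1 ^+ 2 * dot X X <= d / 4.
    rewrite -sqr_enorm -exprMn; apply: le_trans s2.
    rewrite lerXn2r ?nnegrE ?mulr_ge0 ?enorm_ge0 ?(ltW rV0) ?(ltW s0)//.
    by apply: ltW; rewrite mulrC ltr_pdivrMr ?rj0// /r mulrA -exprS.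
  have wd : eta * w (r^-1 *: X) <= d / 4.
    rewrite (le_trans (ler_wpM2l (ltW eta0) wW))// /eta.
    by rewrite invfM mulrA divfK ?gt_eqF.
  have -> : A j.+1 = A j + B j * C * r^-1 `^ phi.
    have -> : r^-1 `^ phi = (d ^+ j)^-1 * r0^-1 `^ phi.
      rewrite /r invfM powRM ?invr_ge0 ?exprn_ge0 1?ltW//; congr (_ * _).
      rewrite -powR_exprn ?(ltW s0)// -[LHS]/((s ^+ j)^-1 `^ phi).
      by rewrite -powR_inv1 ?exprn_ge0 ?(ltW s0)// powRAC powR_inv1 ?powR_ge0.
    rewrite /A /B expr_div_n exprS exprVn.
    have dj : d ^+ j != 0 by rewrite expf_neq0 ?gt_eqF.
    have tj : (2 : R) ^+ j != 0 by rewrite expf_neq0// pnatr_eq0.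
    by field; rewrite dj tj.
  have -> : B j.+1 = B j * (d / 2) by rewrite /B exprSr mulrA.
  rewrite H_dilation//.
  have : B j * (eta * w (r^-1 *: X) + r^-1 ^+ 2 * dot X X) <= B j * (d / 2).
    rewrite ler_pM2l//; apply: (le_trans (lerD wd quad)).
    by rewrite le_eqVlt; apply/orP; left; apply/eqP; field.
  move: (A j) (B j) (H X) (r^-1 `^ phi) (eta * _) (_ * dot X X) (d / 2).
  by move=> *; lra.
move=> X DX Xr0.
have X0 : 0 < enorm X by rewrite enorm_gt0; exact/K_neq0/DK.
have [j /andP[j1 j2]] : exists j, s ^+ j.+1 <= enorm X / r0 < s ^+ j.
  apply: geometric_scale; first by rewrite s0.
  by rewrite divr_gt0//= ltr_pdivrMr// mul1r.
have Xrj : enorm X < s ^+ j * r0 by rewrite -ltr_pdivrMr.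
apply: (le_trans (step j X DX Xrj)).
set x := (enorm X / r0) `^ phi.
have -> : (2 * C + d^-1) * M * x = 2 * C * M * x + M * (d^-1 * x) by ring.
apply: lerD.
  rewrite /x powRM ?enorm_ge0 ?invr_ge0 ?(ltW r00)//.
  rewrite [_ `^ _ * r0^-1 `^ _]mulrC mulrA; apply: ler_pM => //.
  - exact/ltW/H_gt0/DK.
  - by rewrite /A ler_piMr ?gerBl ?exprn_ge0 ?invr_ge0// !mulr_ge0 ?powR_ge0 ?ltW.
  - exact/H_le/DK.
rewrite ler_pM2l// (@le_trans _ _ (d ^+ j))//.
  rewrite lerXn2r ?nnegrE ?divr_ge0 ?(ltW d0)//.
  by rewrite ler_pdivrMr// ler_peMr ?(ltW d0)// ler1n.
rewrite ler_pdivlMl// -exprS -powR_exprn ?(ltW s0)//.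
apply: (ge0_ler_powR (ltW phi_gt0)) => //; rewrite nnegrE.
  by rewrite exprn_ge0// ltW.
by rewrite divr_ge0 ?enorm_ge0// ltW.
Qed.

Hypothesis oK : open K.
Hypothesis critical : phi * gamma = 2 - phi.
Hypothesis w_lateral : nonpos_on_boundary (K `&` eball 1) 1 w.

Lemma w_gt0 X : K X -> enorm X < 1 -> 0 < w X.
Proof.
move=> KX X1; rewrite lt_neqAle eq_sym.
have /andP[w0 _] := w_bound KX X1; rewrite w0 andbT; apply/eqP => wX.
suff : -1 * - (H X `^ (- gamma)) <= 0.
  by rewrite mulrN mulN1r opprK leNgt powR_gt0 ?H_gt0.
apply: (lap_at_max (is_lapZ (-1) (w_lap KX X1))).
have nK : \forall Y \near X, K Y by exact: open_nbhs_nbhs.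
have n1 : \forall Y \near X, eball 1 Y.
  by apply: open_nbhs_nbhs; split => //; exact: open_eball.
apply: filterS2 nK n1 => Y KY Y1.
by rewrite wX mulr0 mulN1r oppr_le0; have /andP[] := w_bound KY Y1.
Qed.

(** By criticality [H ^ (- gamma)] is homogeneous of degree [phi - 2], so
    [w] and [s ^ phi * w (X / s)] solve the same equation. Their difference is
    harmonic, hence of order [enorm X ^ phi], and every dyadic scale between 1
    and [enorm X] contributes one such term to [w]. *)
Lemma critical_growth : exists2 C : R, 0 < C &
  forall X, K X -> enorm X < 1 ->
    w X <= C * (1 + ln (enorm X)^-1) * enorm X `^ phi.
Proof.
have [C0 C00 decay] := cone_decay.
pose s : R := 2^-1.
have s0 : 0 < s by rewrite /s invr_gt0.
have s1 : s < 1 by rewrite /s invf_lt1// ltr1n.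
have sV0 : 0 < s^-1 by rewrite invr_gt0.
pose D := K `&` eball s.
pose z X := w X - s `^ phi * w (s^-1 *: X).
have oD : open D by apply: openI => //; exact: open_eball.
have DK : D `<=` K by move=> X [].
have D1 X : D X -> enorm X < 1 by move=> [_ /lt_trans]; apply.
have KV X : D X -> K (s^-1 *: X) by move=> /DK; exact: K_dilation.
have V1 X : D X -> enorm (s^-1 *: X) < 1.
  by move=> [_ Xs]; rewrite enormZ_ge0 1?ltW// mulrC ltr_pdivrMr// mul1r.
have zw X : D X -> z X <= w X.
  move=> DX; rewrite gerBl mulr_ge0 ?powR_ge0//.
  by have /andP[] := w_bound (KV _ DX) (V1 _ DX).
have cz X : D X -> {for X, continuous z}.
  move=> DX.
  have cdil : {for X, continuous (fun Y : V => s^-1 *: Y)} by move=> U /near_dilation.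
  have cw : {for X, continuous (fun Y => w (s^-1 *: Y))}.
    by apply: (continuous_comp cdil); exact: w_cont (KV _ DX) (V1 _ DX).
  apply: (continuousB (w_cont (DK _ DX) (D1 _ DX))).
  have cst : {for X, continuous (fun _ : V => s `^ phi)} by exact: cst_continuous.
  exact: (continuousM cst cw).
have subz : subharmonic_where_pos D z.
  move=> X DX _; exists z, 0; split => //; last by near=> Y.
  have HV : (H (s^-1 *: X)) `^ (- gamma) = s `^ (2 - phi) * H X `^ (- gamma).
    rewrite H_dilation// powRM ?powR_ge0 ?(ltW (H_gt0 (DK _ DX)))//.
    congr (_ * _); rewrite -powRrM mulrN critical.
    by rewrite -(powR_inv1 (ltW s0)) -powRrM mulN1r opprK.
  have := is_lapB (w_lap (DK _ DX) (D1 _ DX))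
    (is_lapZ (s `^ phi) (is_lap_dilation (w_lap (KV _ DX) (V1 _ DX)))).
  congr (is_lap _ _ _); rewrite HV.
  have -> : s `^ (2 - phi) = s ^+ 2 / s `^ phi.
    by rewrite powRB ?powR_mulrn ?(ltW s0)//; rewrite (gt_eqF s0) implybT.
  by field; rewrite (gt_eqF s0) (gt_eqF (powR_gt0 _ s0)).
have latz : nonpos_on_boundary D s z.
  move=> p clp np ps eps eps0.
  have clp1 : closure (K `&` eball 1) p.
    by apply: closureS clp => Y DY; split; [exact: DK | exact: D1].
  have np1 : ~ (K `&` eball 1) p by move=> [Kp _]; apply: np.
  have := w_lateral clp1 np1 (lt_trans ps s1) eps0.
  apply: filterS => Y wY DY; apply: le_lt_trans (zw _ DY) _; apply: wY.
  by split; [exact: DK | exact: D1].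
have zW X : D X -> enorm X < s -> z X <= W.
  move=> DX _; apply: (le_trans (zw _ DX)).
  by have /andP[] := w_bound (DK _ DX) (D1 _ DX).
pose C1 := C0 * W * s^-1 `^ phi.
pose C2 := W * s^-1 `^ phi.
have sp0 : 0 < s^-1 `^ phi by rewrite powR_gt0.
have C10 : 0 < C1 by rewrite !mulr_gt0.
have C20 : 0 < C2 by rewrite !mulr_gt0.
have zle X : D X -> z X <= C1 * enorm X `^ phi.
  move=> DX; apply: (le_trans (decay D z s W oD DK cz subz latz s0 W_gt0 zW X DX _)).
    by case: DX.
  by rewrite powRM ?enorm_ge0 ?(ltW sV0)// /C1 [_ `^ _ * s^-1 `^ _]mulrC !mulrA.
have step j : forall X, K X -> s ^+ j.+1 <= enorm X < s ^+ j ->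
    w X <= (j%:R * C1 + C2) * enorm X `^ phi.
  elim: j => [|j IH] X KX /andP[sX Xs].
    rewrite expr1 in sX; rewrite expr0 in Xs.
    have /andP[_ /le_trans] := w_bound KX Xs; apply.
    rewrite mul0r add0r /C2 -mulrA ler_peMr ?(ltW W_gt0)//.
    rewrite -powRM ?enorm_ge0 ?(ltW sV0)//.
    have one : (1 : R) = 1 `^ phi by rewrite powR1.
    rewrite {1}one; apply: (ge0_ler_powR (ltW phi_gt0)); rewrite ?nnegrE//.
      by rewrite mulr_ge0 ?enorm_ge0// ltW.
    by rewrite mulrC ler_pdivlMr// mul1r.
  have DX : D X.
    split=> //; apply: lt_le_trans Xs _; rewrite exprS ler_piMr ?(ltW s0)//.
    by rewrite exprn_ile1 ?ltW.
  have Vb : s ^+ j.+1 <= enorm (s^-1 *: X) < s ^+ j.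
    rewrite enormZ_ge0 ?(ltW sV0)// mulrC ler_pdivlMr// ltr_pdivrMr//.
    by rewrite -!exprSr sX Xs.
  have := IH _ (KV _ DX) Vb; rewrite enormZ_ge0 ?(ltW sV0)//.
  rewrite powRM ?enorm_ge0 ?(ltW sV0)// => wV.
  have -> : w X = z X + s `^ phi * w (s^-1 *: X) by rewrite /z subrK.
  have -> : (j.+1%:R * C1 + C2) * enorm X `^ phi =
     C1 * enorm X `^ phi + s `^ phi * ((j%:R * C1 + C2) *
       (s^-1 `^ phi * enorm X `^ phi)).
    have ss : s `^ phi * s^-1 `^ phi = 1.
      by rewrite -powRM ?(ltW s0) ?(ltW sV0)// divff ?powR1// gt_eqF.
    rewrite [X in _ = _ + X]mulrCA [s `^ phi * _]mulrA ss mul1r -natr1; ring.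
  by apply: lerD; rewrite ?zle// ler_pM2l// powR_gt0.
have lnV0 : 0 < ln s^-1 by rewrite ln_gt0// /s invrK ltr1n.
exists (C1 / ln s^-1 + C2); first by rewrite addr_gt0// divr_gt0.
move=> X KX X1.
have X0 : 0 < enorm X by rewrite enorm_gt0; exact: K_neq0.
have [j /andP[j1 j2]] : exists j, s ^+ j.+1 <= enorm X < s ^+ j.
  by apply: geometric_scale; rewrite ?s0 ?X0.
have := step j X KX; rewrite j1 j2 => /(_ isT)/le_trans; apply.
rewrite ler_wpM2r ?powR_ge0//.
have jl : j%:R * ln s^-1 <= ln (enorm X)^-1.
  have -> : j%:R * ln s^-1 = ln (s^-1 ^+ j) by rewrite lnXn ?mulr_natl.
  rewrite ler_ln ?posrE ?exprn_gt0 ?invr_gt0//.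
  by rewrite exprVn lef_pV2 ?posrE ?exprn_gt0// ltW.
have l0 : 0 <= ln (enorm X)^-1 by rewrite (le_trans _ jl)// mulr_ge0 ?(ltW lnV0).
have jC1 : j%:R * C1 <= C1 / ln s^-1 * ln (enorm X)^-1.
  by rewrite mulrAC ler_pdivlMr// [leLHS]mulrAC [leLHS]mulrC ler_pM2l.
have : 0 <= C2 * ln (enorm X)^-1 by rewrite mulr_ge0// ltW.
have : 0 <= C1 / ln s^-1 by rewrite divr_ge0 ?ltW.
move: jC1; move: (C1 / _) (ln (enorm X)^-1) (j%:R * C1) => *; lra.
Unshelve. all: by end_near. Qed.

(** With [a = 1 / (1 + gamma)], the geometric mean [S = H ^ (1 - a) * w ^ a]
    satisfies [S ^ (1 + gamma) = w * H ^ gamma], and its tangent linear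
    combination of [H] and [w] has the Laplacian
    [- a * S / w * H ^ (- gamma) = - a * S ^ (- gamma)]. So for
    [k = 1 + Lam / a] the function [k * S] is a supersolution, and [u - k * S]
    is subharmonic where it is positive. *)
Lemma singular_growth : critical_growth_bound K phi gamma.
Proof.
have [C0 C00 decay] := cone_decay.
have [C C_gt0 wC] := critical_growth.
exists C, C0; split => // Lam D f u r0 M Lam0 oD DK1 cu u0 fLam lapu latu r00 M0 uM.
pose a := (1 + gamma)^-1.
have g1 : 0 < 1 + gamma by rewrite addr_gt0.
have a0 : 0 < a by rewrite invr_gt0.
have a1 : a <= 1 by rewrite invf_le1// lerDl ltW.
have a01 : 0 <= a <= 1 by rewrite ltW.
pose k := 1 + Lam * (1 + gamma).
have k0 : 0 < k by rewrite addr_gt0 ?mulr_gt0.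
have DK X : D X -> K X by move=> /DK1[].
have D1 X : D X -> enorm X < 1 by move=> /DK1[].
have wpos X : D X -> 0 < w X by move=> DX; exact: w_gt0 (DK _ DX) (D1 _ DX).
have Hpos X : D X -> 0 < H X by move=> DX; exact: H_gt0 (DK _ DX).
pose S X := geo_mean a (H X) (w X).
have S0 X : 0 < S X by exact: expR_gt0.
pose z X := u X - k * S X.
have zu X : z X <= u X by rewrite gerBl mulr_ge0 ?(ltW k0) ?(ltW (S0 X)).
have cz X : D X -> {for X, continuous z}.
  move=> DX.
  have cst c : {for X, continuous (fun _ : V => c : R)} by exact: cst_continuous.
  have cln (v : V -> R) : {for X, continuous v} -> 0 < v X ->
      {for X, continuous (fun Y => ln (v Y))}.
    by move=> cv v0; apply: continuous_comp cv (continuous_ln v0).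
  have cs : {for X, continuous (fun Y => (1 - a) * ln (H Y) + a * ln (w Y))}.
    apply: continuousD.
      exact: (continuousM (cst _) (cln _ (H_cont (DK _ DX)) (Hpos _ DX))).
    exact: (continuousM (cst _) (cln _ (w_cont (DK _ DX) (D1 _ DX)) (wpos _ DX))).
  have cS : {for X, continuous S} := continuous_comp cs (@continuous_expR R _).
  exact: (continuousB (cu _ DX) (continuousM (cst k) cS)).
have latz : nonpos_on_boundary D r0 z.
  move=> p cp np pr eps eps0; apply: filterS (latu p cp np pr eps eps0) => Y uY DY.
  exact: le_lt_trans (zu Y) (uY DY).
have subz : subharmonic_where_pos D z.
  move=> X DX zX0.
  pose lin Y := S X * ((1 - a) / H X) * H Y + S X * (a / w X) * w Y.
  exists (fun Y => u Y - k * lin Y), (- (f X * u X `^ (- gamma)) -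
    k * (S X * ((1 - a) / H X) * 0 + S X * (a / w X) * - (H X `^ (- gamma)))).
  split.
  - apply: is_lapB; first exact: lapu.
    apply: is_lapZ; apply: is_lapD; apply: is_lapZ; first exact/H_lap/DK.
    by apply: w_lap; [exact: DK | exact: D1].
  - have SX : S X `^ (- gamma) = S X / w X * H X `^ (- gamma).
      rewrite /powR !gt_eqF ?Hpos ?S0// /S /geo_mean expRK.
      rewrite -[in (w X)^-1](@lnK _ (w X)) ?posrE ?wpos// -expRN -!expRD.
      by congr expR; rewrite /a; field; rewrite gt_eqF.
    have uS : u X `^ (- gamma) <= S X `^ (- gamma).
      rewrite !powRN lef_pV2 ?posrE ?powR_gt0 ?u0//.
      apply: (ge0_ler_powR (ltW gamma_gt0)); rewrite ?nnegrE ?(ltW (S0 X)) ?(ltW (u0 _ DX))//.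
      apply: ltW; apply: le_lt_trans (_ : k * S X < _); last by rewrite -subr_gt0.
      by rewrite ler_peMl ?(ltW (S0 X))// /k lerDl mulr_ge0 ?ltW.
    have fu : f X * u X `^ (- gamma) <= Lam * S X `^ (- gamma).
      apply: (@le_trans _ _ (Lam * u X `^ (- gamma))).
        by rewrite ler_wpM2r ?powR_ge0 ?fLam.
      by rewrite ler_pM2l.
    have ka : Lam * S X `^ (- gamma) <= k * a * S X `^ (- gamma).
      rewrite ler_wpM2r ?powR_ge0// /k /a mulrDl mul1r mulfK ?gt_eqF//.
      by rewrite lerDr invr_ge0 ltW.
    rewrite mulr0 add0r.
    have -> : - (f X * u X `^ (- gamma)) -
        k * (S X * (a / w X) * - H X `^ (- gamma)) =
      k * a * (S X / w X * H X `^ (- gamma)) - f X * u X `^ (- gamma) by ring.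
    by rewrite -SX subr_ge0 (le_trans fu).
  - rewrite /z /lin; congr (_ - k * _).
    by field; rewrite !gt_eqF ?Hpos ?wpos.
  - have nD : \forall Y \near X, D Y by exact: open_nbhs_nbhs.
    apply: filterS nD => Y DY; rewrite lerD2l lerN2 ler_pM2l//.
    by apply: geo_mean_tangent; rewrite ?Hpos ?wpos.
have zM X : D X -> enorm X < r0 -> z X <= M.
  by move=> DX Xr; apply: le_trans (zu X) (uM X DX Xr).
move=> X DX Xr.
have DK' : D `<=` K by [].
have := decay D z r0 M oD DK' cz subz latz r00 M0 zM X DX Xr.
rewrite /z lerBlDl => /le_trans; apply; rewrite lerD2r -mulrA ler_pM2l//.
have l0 : 0 <= ln (enorm X)^-1.
  rewrite ln_ge0// -[leLHS]invr1 lef_pV2 ?posrE ?ltr01 ?enorm_gt0 ?(ltW (D1 _ DX))//.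
  exact/K_neq0/DK.
apply: geo_mean_le; rewrite ?Hpos ?wpos//.
- exact/H_le/DK.
- by apply: wC; [exact: DK | exact: D1].
- by rewrite mulr_gt0// (lt_le_trans ltr01)// lerDl.
Qed.

End Growth.

(** * Classical solutions and Lipschitz cones *)

Section ClassicalDirichlet.
Context {R : realType} {n : nat}.
Local Notation V := 'rV[R]_n.
Implicit Types (X Y p : V) (A : set V) (u w : V -> R).

Lemma within_vanishing A u p : {within A, continuous u} -> A p -> u p = 0 ->
  forall eps : R, 0 < eps -> \forall X \near p, A X -> `|u X| < eps.
Proof.
move=> /subspace_continuousP cu Ap up0 eps eps0.
have cup : u X @[X --> within A (nbhs p)] --> u p by exact: cu.
rewrite up0 in cup.
have : \forall X \near within A (nbhs p), `|0 - u X| < eps.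
  by move/cvgrPdist_lt : cup => /(_ _ eps0).
by rewrite near_withinE; apply: filterS => X + AX => /(_ AX); rewrite sub0r normrN.
Qed.

Lemma compact_norm_bound A u : compact A -> {within A, continuous u} ->
  exists M : R, forall X, A X -> `|u X| <= M.
Proof.
move=> cA cu; have [[X0 AX0]|A0] := pselect (A !=set0); last first.
  by exists 0 => X AX; exfalso; apply: A0; exists X.
have ne : A !=set0 by exists X0.
have [c _ cmax] := EVT_max_rV ne cA cu.
have [d _ dmin] := EVT_min_rV ne cA cu.
exists (`|u c| + `|u d|) => X /mem_set AX.
have := cmax _ AX; have := dmin _ AX.
have := ler_norm (u c); have := ler_norm (- u d); rewrite normrN.
have := normr_ge0 (u c); have := normr_ge0 (u d).
rewrite ler_norml; move: `|u c| `|u d| (u c) (u d) (u X) => *; lra.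
Qed.

Lemma dirichlet_solution_facts A (h w : V -> R) (M : R) :
  open A -> (forall X, A X -> enorm X <= M) -> (forall X, A X -> 0 < h X) ->
  dirichlet_solution A h w ->
  [/\ exists2 W : R, 0 < W & forall X, A X -> 0 <= w X <= W,
      forall X, A X -> {for X, continuous w},
      forall X, A X -> is_lap w X (- h X) &
      forall r, nonpos_on_boundary A r w].
Proof.
move=> oA bA h0 [cw C2w eqw w0].
have lapw X : A X -> is_lap w X (- h X).
  by move=> AX; rewrite -(eqw _ AX) opprK; exact: (C2_is_lap oA).
have contw X : A X -> {for X, continuous w} by move=> /C2w[].
have near0 p : closure A p -> ~ A p -> forall eps : R, 0 < eps ->
    \forall X \near p, A X -> `|w X| < eps.
  move=> clp np eps eps0.
  apply: filterS (within_vanishing cw clp (w0 _ (conj clp np)) eps0).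
  by move=> X wX /subset_closure /wX.
split => //; last first.
  move=> r p clp np _ eps eps0; apply: filterS (near0 p clp np eps eps0).
  by move=> X wX /wX; apply: le_lt_trans; exact: ler_norm.
have ccA : compact (closure A).
  apply: bounded_closed_compact; last exact: closed_closure.
  by apply: (@bounded_enorm _ _ _ M) => p; exact: closure_enorm_le.
have [W wW] := compact_norm_bound ccA cw.
exists (`|W| + 1) => [|X AX]; first by rewrite ltr_wpDl.
apply/andP; split.
  have : - w X <= 0; last by rewrite oppr_le0.
  apply: (@maximum_principle _ _ A (fun X => - w X) M) => //.
  - by move=> Y AY; apply: continuousN; exact: contw.
  - move=> p clp np eps eps0; apply: filterS (near0 p clp np eps eps0).
    by move=> Y wY /wY; apply: le_lt_trans; rewrite -normrN; exact: ler_norm.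
  - move=> Y AY _; exists (fun Y => -1 * w Y), (-1 * - h Y); split.
    + exact/is_lapZ/lapw.
    + by rewrite mulN1r opprK h0.
    + by rewrite mulN1r.
    + by near=> Z; rewrite mulN1r.
rewrite (le_trans (ler_norm _))// (le_trans (wW _ (subset_closure AX)))//.
by rewrite (le_trans (ler_norm _))// lerDl.
Unshelve. all: by end_near. Qed.

End ClassicalDirichlet.

Section LipschitzCone.
Context {R : realType} {n : nat}.
Local Notation V := 'rV[R]_n.
Implicit Types (X Y p e : V) (Sigma : set V).

Lemma lipschitz_fun_continuous (h : V -> R) : lipschitz_fun h -> continuous h.
Proof.
move=> [k hk] X.
suff H : forall eps : R, 0 < eps -> \forall Y \near X, `|h X - h Y| <= eps.
  by move/cvgrPdist_le : H.
move=> eps eps0.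
have k1 : 0 < `|k| + 1 by rewrite ltr_wpDl.
have : \forall Y \near X, enorm (Y - X) < eps / (`|k| + 1).
  by apply: (cvgr_lt _ (@enormB_continuous R n X X)); rewrite subrr enorm0 divr_gt0.
apply: filterS => Y; rewrite -enormN opprB => XY.
apply: (le_trans (hk X Y)); apply: (@le_trans _ _ ((`|k| + 1) * enorm (X - Y))).
  by rewrite ler_wpM2r ?enorm_ge0// (le_trans (ler_norm k))// lerDl.
by rewrite mulrC -ler_pdivlMr// ltW.
Qed.

Lemma closure_cone_normalize Sigma X : Sigma `<=` sphere -> X != 0 ->
  closure (cone Sigma) X -> closure Sigma ((enorm X)^-1 *: X).
Proof.
move=> sph X0 clX B nB.
have nX : \forall Y \near X, B ((enorm Y)^-1 *: Y).
  exact: (normalize_continuous X0 nB).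
have [Y [cY BY]] := clX _ nX.
exists ((enorm Y)^-1 *: Y); split => //.
by apply/(coneP sph) => //; exact: cone_neq0 cY.
Qed.

(** The cone over a Lipschitz domain is the interior of its closure, up to the
    vertex: at a boundary point [p] of [Sigma] the domain lies above a graph
    in the direction [e], so moving from [p] in the direction [- e] leaves the
    closure of [Sigma]. *)
Lemma interior_closure_cone Sigma U X :
  Sigma `<=` sphere -> lipschitz_boundary Sigma ->
  open U -> U `<=` closure (cone Sigma) -> U X -> X != 0 -> cone Sigma X.
Proof.
move=> sph lip oU UC UX X0; apply/(coneP sph X0).
set p := (enorm X)^-1 *: X.
have Xpos : 0 < enorm X by rewrite enorm_gt0.
have XE : X = enorm X *: p by rewrite scalerA divff ?scale1r// gt_eqF.
have p1 : enorm p = 1 by exact: enorm_normalize.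
have clp : closure Sigma p by apply: closure_cone_normalize => //; exact: UC.
apply: contrapT => np.
have [e [h [r [e1 ep hlip r0 hP]]]] := lip p (conj clp np).
have pp : dot p p = 1 by rewrite -sqr_enorm p1 expr1n.
have ee : dot e e = 1 by rewrite -sqr_enorm e1 expr1n.
have pe : dot p e = 0 by rewrite dotC.
have h0 : 0 <= h 0.
  rewrite leNgt; apply/negP => h0; apply: np; apply/hP => //.
    by rewrite subrr enorm0.
  by rewrite pe pp scale0r subr0 scale1r subrr.
pose Y t : V := (- (t * enorm X)) *: e + X.
have YE t : Y t = enorm X *: (p - t *: e).
  rewrite [in RHS]scalerBr -XE scalerA /Y scaleNr addrC mulrC //.
have cN Z : Z != 0 -> {for Z, continuous (fun Y : V => enorm ((enorm Y)^-1 *: Y - p))}.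
  move=> Z0.
  exact: (continuous_comp (normalize_continuous Z0) (@enormB_continuous R n p _)).
have nearU : \forall Z \near X, [/\ U Z, Z != 0 & enorm ((enorm Z)^-1 *: Z - p) < r].
  have nU : \forall Z \near X, U Z by exact: open_nbhs_nbhs.
  have nr : \forall Z \near X, enorm ((enorm Z)^-1 *: Z - p) < r.
    by apply: (cvgr_lt _ (cN _ X0)); rewrite subrr enorm0.
  by apply: filterS3 nU (near_neq0 X0) nr.
have := @near_line _ _ _ X (- e) nearU.
move=> /(@nbhs_norm0P R R^o)[d /= d0 dP].
pose t := d / 2 / enorm X.
have t0 : 0 < t by rewrite !divr_gt0.
have [UY Y0 Yr] : [/\ U (Y t), Y t != 0 & enorm ((enorm (Y t))^-1 *: Y t - p) < r].
  have -> : Y t = (d / 2) *: (- e) + X.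
    by rewrite /Y /t divfK ?gt_eqF// scalerN scaleNr.
  by apply: dP; rewrite /= gtr0_norm ?divr_gt0// ltr_pdivrMr// ltr_pMr// ltr1n.
have clY := closure_cone_normalize sph Y0 (UC _ UY).
set q := (enorm (Y t))^-1 *: Y t in Yr clY.
pose G (theta : V) := dot theta e - h (theta - dot theta e *: e - dot theta p *: p).
have Gq : G q < 0.
  have [c c0 qE] : exists2 c, 0 < c & q = c *: (p - t *: e).
    exists ((enorm (Y t))^-1 * enorm X); last by rewrite /q {2}YE scalerA.
    by rewrite mulr_gt0// invr_gt0 enorm_gt0.
  have qe : dot q e = - (c * t).
    by rewrite qE dotZl dotDl pe add0r -scaleNr dotZl ee mulr1 mulrN.
  have qp : dot q p = c.
    by rewrite qE dotZl dotDl pp -scaleNr dotZl ep mulr0 addr0 mulr1.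
  have q0 : q - dot q e *: e - dot q p *: p = 0.
    by rewrite qe qp qE; apply/rowP => i; rewrite !mxE; ring.
  rewrite /G q0 qe -opprD oppr_lt0; apply: ltr_pwDl => //.
  by rewrite mulr_gt0.
have cs (a : V) : {for q, continuous (fun theta : V => dot theta a *: a)}.
  have ca : {for q, continuous (fun _ : V => a)} by exact: cst_continuous.
  exact: (continuousZ (@dotl_continuous R n a q) ca).
have cproj : {for q, continuous
    (fun theta : V => theta - dot theta e *: e - dot theta p *: p)}.
  exact: (continuousB (continuousB (@cvg_id _ (nbhs q)) (cs e)) (cs p)).
have ch : {for q, continuous
    (fun theta : V => h (theta - dot theta e *: e - dot theta p *: p))}.
  exact: (continuous_comp cproj (@lipschitz_fun_continuous h hlip _)).
have cG : {for q, continuous G}.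
  exact: (continuousB (@dotl_continuous R n e q) ch).
have nG : \forall theta \near q, G theta < 0 by exact: (cvgr_lt _ cG).
have nr : \forall theta \near q, enorm (theta - p) < r.
  exact: (cvgr_lt _ (@enormB_continuous R n p q)).
have nGr : \forall theta \near q, G theta < 0 /\ enorm (theta - p) < r.
  exact: filterI.
have [theta [Sth [Gth thr]]] := clY _ nGr.
have /hP := sph _ Sth; move=> /(_ thr)[/(_ Sth) + _].
by rewrite -subr_gt0 ltNge ltW.
Qed.

End LipschitzCone.

(** * The grounded cylinder *)

Lemma lipschitz_of_C01_norm {R : realType} {k : nat} (r L : R)
    (g : 'rV[R]_k -> R) : 0 <= r -> (C01_norm (cball r) g <= L%:E)%E ->
  0 <= L /\ forall y z, cball r y -> cball r z ->
    `|g y - g z| <= L * enorm (y - z).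
Proof.
move=> r0; rewrite /C01_norm.
set S1 := ereal_sup _; set S2 := ereal_sup _ => SL.
have c0 : cball r (0 : 'rV[R]_k) by rewrite /cball/= enorm0.
have S10 : (0 <= S1)%E.
  apply: (@le_trans _ _ (`|g 0|%:E)); first by rewrite lee_fin.
  by apply: ereal_sup_ubound; exists 0.
have S2L : (S2 <= L%:E)%E by apply: le_trans SL; rewrite leeDr.
have quot y z : cball r y -> cball r z -> `|g y - g z| / enorm (y - z) <= L.
  move=> cy cz; rewrite -lee_fin; apply: le_trans S2L.
  by apply: ereal_sup_ubound; exists (y, z).
split; first by have := quot _ _ c0 c0; rewrite subrr normr0 mul0r.
move=> y z cy cz; have [->|yz] := eqVneq y z.
  by rewrite !subrr normr0 enorm0 mulr0.
by rewrite -ler_pdivrMr ?quot// enorm_gt0 subr_eq0.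
Qed.

Section HorizVert.
Context {R : realType} {m : nat}.
Local Notation V := 'rV[R]_m.+1.
Implicit Types (X Y p : V).

Lemma dot_horiz_vert X : dot X X = dot (horiz X) (horiz X) + vert X ^+ 2.
Proof.
rewrite /dot big_ord_recr/=; congr (_ + _).
apply: eq_bigr => i _; rewrite /horiz !mxE.
by have -> : widen_ord (leqnSn m) i = lift ord_max i by apply/val_inj/esym/lift_max.
Qed.

Lemma horiz_le_enorm X : enorm (horiz X) <= enorm X.
Proof. by rewrite ler_wsqrtr// dot_horiz_vert lerDl sqr_ge0. Qed.

Lemma vert_le_enorm X : `|vert X| <= enorm X.
Proof. exact: coord_le_enorm. Qed.

Lemma enorm_le_horiz_vert X : enorm X <= enorm (horiz X) + `|vert X|.
Proof.
rewrite -(@ler_pXn2r _ 2)// ?nnegrE ?addr_ge0 ?enorm_ge0//.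
rewrite sqr_enorm dot_horiz_vert sqrrD sqr_enorm real_normK ?num_real//.
by rewrite lerD2r lerDl mulrn_wge0// mulr_ge0 ?enorm_ge0.
Qed.

Lemma horizB X Y : horiz (X - Y) = horiz X - horiz Y.
Proof. by apply/rowP => i; rewrite !mxE. Qed.

Lemma vertB X Y : vert (X - Y) = vert X - vert Y.
Proof. by rewrite /vert !mxE. Qed.

(** Continuity is read off from [dot_horiz_vert]. *)
Lemma enorm_horiz_continuous : continuous (fun X : V => enorm (horiz X)).
Proof.
have -> : (fun X : V => enorm (horiz X)) =
    (fun X : V => Num.sqrt (dot X X - X 0 ord_max * X 0 ord_max)).
  by apply/funext => X; rewrite dot_horiz_vert expr2 addrK.
move=> X; have cv : {for X, continuous (fun X : V => X 0 ord_max)}.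
  exact: (@coord_continuous R 1 m.+1 0 ord_max X).
have cd := continuousB (@dot_continuous R m.+1 X) (continuousM cv cv).
exact: (continuous_comp cd (@sqrt_continuous R _)).
Qed.

End HorizVert.

Section GroundedCylinderFacts.
Context {R : realType} {m : nat}.
Local Notation V := 'rV[R]_m.+1.
Implicit Types (X Y p : V).

Variables (g : 'rV[R]_m -> R) (r L : R).
Hypothesis r_gt0 : 0 < r.
Hypothesis L_ge0 : 0 <= L.
Hypothesis g0 : g 0 = 0.
Hypothesis g_lip : forall y z, cball r y -> cball r z ->
  `|g y - g z| <= L * enorm (y - z).
Local Notation GC := (grounded_cylinder g r).

Lemma height_lip X Y : enorm (horiz X) <= r -> enorm (horiz Y) <= r ->
  `|(vert X - g (horiz X)) - (vert Y - g (horiz Y))| <= (1 + L) * enorm (X - Y).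
Proof.
move=> hX hY.
have -> : vert X - g (horiz X) - (vert Y - g (horiz Y)) =
  vert (X - Y) - (g (horiz X) - g (horiz Y)) by rewrite vertB; ring.
rewrite (le_trans (ler_normB _ _))// mulrDl mul1r lerD ?vert_le_enorm//.
rewrite (le_trans (g_lip hX hY))// ler_wpM2l// -horizB.
exact: horiz_le_enorm.
Qed.

Lemma near_small X (eps : R) : 0 < eps -> \forall Y \near X, enorm (X - Y) < eps.
Proof.
move=> eps0; have : \forall Y \near X, enorm (Y - X) < eps.
  by apply: (cvgr_lt _ (@enormB_continuous R _ X X)); rewrite subrr enorm0.
by apply: filterS => Y; rewrite -enormN opprB.
Qed.

Let L1 : 0 < 1 + L. Proof. by rewrite (lt_le_trans ltr01)// lerDl. Qed.

Lemma near_height X (eps : R) : enorm (horiz X) <= r -> 0 < eps ->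
  \forall Y \near X, enorm (horiz Y) <= r ->
    `|(vert X - g (horiz X)) - (vert Y - g (horiz Y))| < eps.
Proof.
move=> hX eps0; have := near_small X (divr_gt0 eps0 L1).
apply: filterS => Y XY hY; apply: le_lt_trans (height_lip hX hY) _.
by rewrite mulrC -ltr_pdivlMr.
Qed.

Lemma closed_grounded_cylinder : closed GC.
Proof.
move=> p clp.
have hp : enorm (horiz p) <= r.
  rewrite leNgt; apply/negP => rp.
  have : \forall Y \near p, r < enorm (horiz Y).
    exact: (cvgr_gt _ (@enorm_horiz_continuous R m p)).
  by move=> /clp[Y [[hY _] /=]]; rewrite ltNge hY.
have ht (eps : R) : 0 < eps -> exists Y, GC Y /\
    `|(vert p - g (horiz p)) - (vert Y - g (horiz Y))| < eps.
  move=> eps0; have /clp[Y [GY YH]] := near_height hp eps0.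
  by exists Y; split => //; apply: YH; case: GY.
split=> //; apply/andP; split; rewrite leNgt; apply/negP => bad.
  have [|Y [[_ /andP[Y0 _]]]] := ht (- (vert p - g (horiz p))).
    by rewrite oppr_gt0.
  move: (vert Y - _) (vert p - _) Y0 bad => y q y0 q0.
  by rewrite ltr_norml => /andP[]; lra.
have [|Y [[_ /andP[_ Yr]]]] := ht (vert p - g (horiz p) - r).
  by rewrite subr_gt0.
move: (vert Y - _) (vert p - _) Yr bad => y q y0 q0.
by rewrite ltr_norml => /andP[]; lra.
Qed.

Lemma grounded_cylinder_bounded X : GC X -> enorm X <= r + (r + L * r).
Proof.
move=> [hX /andP[h0 hr]].
rewrite (le_trans (enorm_le_horiz_vert X))// lerD//.
have -> : vert X = (vert X - g (horiz X)) + g (horiz X) by rewrite subrK.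
apply: (le_trans (ler_normD _ _)); apply: lerD; first by rewrite ger0_norm.
have c0 : cball r (0 : 'rV[R]_m) by rewrite /cball/= enorm0 ltW.
have := g_lip hX c0; rewrite g0 !subr0 => /le_trans; apply.
exact: ler_wpM2l.
Qed.

Lemma compact_grounded_cylinder : compact GC.
Proof.
apply: bounded_closed_compact closed_grounded_cylinder.
exact: bounded_enorm grounded_cylinder_bounded.
Qed.

Lemma interior_grounded_cylinder X : enorm (horiz X) < r ->
  0 < vert X - g (horiz X) < r -> GC° X.
Proof.
move=> hX /andP[h0 hr].
pose t := vert X - g (horiz X).
have e0 : 0 < Num.min t (r - t) by rewrite lt_min h0 subr_gt0.
have nh : \forall Y \near X, enorm (horiz Y) < r.
  exact: (cvgr_lt _ (@enorm_horiz_continuous R m X)).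
suff : \forall Y \near X, GC Y by [].
apply: filterS2 nh (near_height (ltW hX) e0) => Y hY /(_ (ltW hY)).
rewrite -/t lt_min => /andP[d1 d2]; split; first exact: ltW.
move: d1 d2; move: (vert Y - _) => y; rewrite !ltr_norml.
by move=> /andP[? ?] /andP[? ?]; apply/andP; split; lra.
Qed.

(** The side and the top of the cylinder stay away from the origin, because
    [g 0 = 0] and [g] is Lipschitz. *)
Lemma grounded_cylinder_near0 X (c : R) : 0 < c -> (1 + L) * c < r ->
  GC X -> enorm X < c -> (graph g `&` GC) X \/ GC° X.
Proof.
move=> c0 Lc GX Xc; have [hX /andP[h0 hr]] := GX.
have hc : enorm (horiz X) < c by exact: le_lt_trans (horiz_le_enorm X) Xc.
have cr : c < r by apply: le_lt_trans Lc; rewrite mulrDl mul1r lerDl mulr_ge0// ltW.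
move: h0; rewrite le_eqVlt => /orP[/eqP h0|h0].
  by left; split => //; rewrite /graph/=; apply/eqP; rewrite -subr_eq0 -h0.
right; apply: interior_grounded_cylinder; first exact: lt_trans cr.
rewrite h0/=; apply: le_lt_trans Lc.
have h00 : enorm (horiz (0 : V)) <= r.
  by rewrite (le_trans (horiz_le_enorm _))// enorm0 ltW.
have := height_lip hX h00.
have -> : horiz (0 : V) = 0 by apply/rowP => i; rewrite !mxE.
rewrite g0 /vert mxE !subr0 -/(vert X) => H.
apply: (le_trans (ler_norm _)); apply: (le_trans H).
by rewrite ler_pM2l// ltW.
Qed.

Lemma interior_grounded_cylinder_neq0 X : GC° X -> X != 0.
Proof.
move=> iX; apply/eqP => X0; rewrite X0 in iX.
have := @near_line _ _ GC 0 (- delta_mx 0 ord_max : V) iX.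
move=> /(@nbhs_norm0P R R^o)[d /= d0 dP].
have := dP (d / 2).
rewrite /= gtr0_norm ?divr_gt0// ltr_pdivrMr// ltr_pMr// ltr1n => /(_ isT)[_].
have -> : horiz (d / 2 *: - delta_mx 0 ord_max + 0 : V) = 0.
  by apply/rowP => i; rewrite !mxE/= eq_sym (negPf (neq_lift _ _)) oppr0 mulr0 addr0.
rewrite g0 subr0 /vert !mxE !eqxx/= mulrN mulr1 addr0 => /andP[].
by rewrite oppr_ge0 leNgt divr_gt0.
Qed.

Definition cylinder_center : V := (r / 2) *: delta_mx 0 ord_max.

Lemma ball_in_grounded_cylinder X (rho : R) : (1 + L) * rho < r / 2 ->
  enorm (X - cylinder_center) <= rho -> GC° X.
Proof.
move=> Lr Xr.
have rho0 : 0 <= rho by exact: le_trans (enorm_ge0 _) Xr.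
have hc : horiz cylinder_center = 0.
  by apply/rowP => i; rewrite !mxE/= eq_sym (negPf (neq_lift _ _)) mulr0.
have vc : vert cylinder_center = r / 2 by rewrite /vert !mxE !eqxx mulr1.
have rr : rho < r.
  apply: (@le_lt_trans _ _ ((1 + L) * rho)).
    by rewrite mulrDl mul1r lerDl mulr_ge0.
  by apply: lt_trans Lr _; rewrite ltr_pdivrMr// ltr_pMr// ltr1n.
have hX : enorm (horiz X) < r.
  apply: le_lt_trans rr; apply: le_trans Xr.
  have -> : horiz X = horiz (X - cylinder_center) by rewrite horizB hc subr0.
  exact: horiz_le_enorm.
apply: interior_grounded_cylinder => //.
have hc' : enorm (horiz cylinder_center) <= r by rewrite hc enorm0 ltW.
have := height_lip (ltW hX) hc'; rewrite hc g0 vc subr0.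
move=> H; have : `|vert X - g (horiz X) - r / 2| < r / 2.
  by apply: le_lt_trans H _; apply: le_lt_trans Lr; rewrite ler_pM2l.
move: (vert X - _) => t; rewrite ltr_norml => /andP[? ?].
by apply/andP; split; lra.
Qed.

(** Comparison with a paraboloid in a ball of the cylinder: there
    [- Delta u >= lam * N ^ (- gamma)], so [u] is at least
    [lam * N ^ (- gamma) * rho ^ 2 / (4 * (m + 1))] at the center. *)
Lemma singular_solution_lower_bound (gamma lam N : R) (f u : V -> R) :
  0 < gamma -> 0 < lam ->
  (forall X, GC° X -> lam <= f X) ->
  singular_solution gamma f g r u ->
  0 < N -> (forall X, GC X -> u X <= N) ->
  forall rho, 0 < rho -> (1 + L) * rho < r / 2 ->
  lam * rho ^+ 2 / (4 * m.+1%:R) <= N `^ (1 + gamma).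
Proof.
move=> gamma0 lam0 flam [[cu C2u] u0 upos equ _] N0 uN rho rho0 Lrho.
(* Half of the coefficient for which the paraboloid has Laplacian
   [- lam * N ^ (- gamma)]; the comparison needs a strict inequality. *)
pose k := lam * N `^ (- gamma) / (4 * m.+1%:R).
have k0 : 0 < k by rewrite divr_gt0 ?mulr_gt0 ?powR_gt0.
pose q X := dot (X - cylinder_center) (X - cylinder_center).
pose D : set V := [set X | enorm (X - cylinder_center) < rho].
have DGC X : D X -> GC° X by move=> /ltW; exact: ball_in_grounded_cylinder.
have oD : open D.
  rewrite openE => X DX.
  suff : \forall Y \near X, enorm (Y - cylinder_center) < rho by [].
  exact: (cvgr_lt _ (@enormB_continuous R _ cylinder_center X)).
have lapu X : D X -> is_lap u X (- (f X * u X `^ (- gamma))).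
  move=> DX; rewrite -(equ _ (DGC _ DX)) opprK.
  by apply: (C2_is_lap (@open_interior _ GC) C2u); exact: DGC.
have cq X : {for X, continuous (fun Y => k * (rho ^+ 2 - q Y))}.
  have c1 c : {for X, continuous (fun _ : V => c : R)} by exact: cst_continuous.
  have cE := @enormB_continuous R _ cylinder_center X.
  have -> : (fun Y => k * (rho ^+ 2 - q Y)) =
      (fun Y => k * (rho ^+ 2 - enorm (Y - cylinder_center) * enorm (Y - cylinder_center))).
    by apply/funext => Y; rewrite /q -sqr_enorm -expr2.
  exact: (continuousM (c1 k) (continuousB (c1 _) (continuousM cE cE))).
have : k * (rho ^+ 2 - q cylinder_center) - u cylinder_center <= 0.
  apply: (@maximum_principle _ _ D (fun X => k * (rho ^+ 2 - q X) - u X)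
     (r + (r + L * r)) oD).
  - by move=> X /DGC/interior_subset; exact: grounded_cylinder_bounded.
  - move=> X DX; have cuX : {for X, continuous u} by have [] := C2u _ (DGC _ DX).
    exact: (continuousB (cq X) cuX).
  - move=> p clp np eps eps0.
    have : \forall X \near p, k * (rho ^+ 2 - q X) < eps.
      apply: (cvgr_lt _ (cq p)); apply: le_lt_trans eps0.
      rewrite pmulr_rle0// subr_le0 /q -sqr_enorm.
      rewrite lerXn2r ?nnegrE ?enorm_ge0 ?(ltW rho0)//.
      by rewrite leNgt; apply/negP.
    apply: filterS => X kX DX; apply: le_lt_trans kX.
    by rewrite gerBl; apply: u0; move/DGC/interior_subset : DX.
  - move=> X DX _; have GX : GC X by move/DGC/interior_subset : (DX).
    exists (fun Y => k * (rho ^+ 2 - q Y) - u Y),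
      (k * (0 - 2 * m.+1%:R) - - (f X * u X `^ (- gamma))); split => //.
    + apply: is_lapB; last exact: lapu.
      apply: is_lapZ; apply: is_lapB (is_lap_dist2 _ _).
      exact: is_lap_cst.
    + rewrite opprK sub0r mulrN addrC subr_gt0.
      apply: (@lt_le_trans _ _ (lam * N `^ (- gamma))).
        have -> : k * (2 * m.+1%:R) = lam * N `^ (- gamma) / 2.
          have M0 : (m.+1%:R : R) != 0 by rewrite pnatr_eq0.
          by rewrite /k; move: (m.+1%:R : R) M0 => M M0; field.
        by rewrite ltr_pdivrMr// ltr_pMr ?mulr_gt0 ?powR_gt0// ltr1n.
      apply: ler_pM => //; rewrite ?powR_ge0 ?(ltW lam0)//.
        exact/flam/DGC.
      rewrite !powRN lef_pV2 ?posrE ?powR_gt0 ?upos//; last exact: DGC.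
      apply: (ge0_ler_powR (ltW gamma0)); rewrite ?nnegrE ?u0 ?uN ?(ltW N0)//.
    + by near=> Y.
  - by rewrite /D/= subrr enorm0.
have -> : q cylinder_center = 0 by rewrite /q subrr -sqr_enorm enorm0 expr0n.
rewrite subr0 subr_le0 => ku.
have ce : GC cylinder_center.
  have /DGC/interior_subset : D cylinder_center by rewrite /D/= subrr enorm0.
  by [].
have kN := le_trans ku (uN _ ce).
rewrite powRD; last by apply/implyP => _; rewrite gt_eqF.
rewrite powRr1 ?(ltW N0)// -ler_pdivrMr ?powR_gt0// -powRN.
by apply: le_trans kN; rewrite le_eqVlt; apply/orP; left; apply/eqP; rewrite /k; ring.
Unshelve. all: by end_near. Qed.

End GroundedCylinderFacts.

(** * The upper bound *)

Lemma critical_cone_growth (R : realType) (n : nat) (Sigma : set 'rV[R]_n)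
    (E w : 'rV[R]_n -> R) (phi gamma : R) :
  0 < gamma -> phi = 2 / (1 + gamma) ->
  spherical_domain Sigma -> frequency Sigma phi ->
  first_dirichlet_eigenfunction Sigma E ->
  dirichlet_solution (cone Sigma `&` eball 1)
    (fun X => homogeneous_ext phi E X `^ (- gamma)) w ->
  critical_growth_bound (cone Sigma) phi gamma.
Proof.
move=> gamma0 critical [nonempty [U [oU SE]] conn] [phi0 [mu mu1 phimu]].
move=> [[mu' mu1' [E2 _ _ _ eig]] E01 _] wsol.
have sph : Sigma `<=` sphere by rewrite SE; exact: subIsetl.
have mumu : mu' = mu.
  by apply/eqP; rewrite eq_le mu1'.2 ?mu1.2//; [exact: mu1'.1 | exact: mu1.1].
rewrite {}mumu in eig.
have E0 theta : Sigma theta -> 0 < E theta by move=> /E01/andP[].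
have E1 theta : Sigma theta -> E theta <= 1 by move=> /E01/andP[].
have g1 : 0 < 1 + gamma by rewrite addr_gt0.
have phi2 : phi < 2.
  by rewrite critical ltr_pdivrMr// ltr_pMr// ltrDl.
have phig : phi * gamma = 2 - phi.
  by rewrite critical; field; rewrite gt_eqF.
have oC : open (cone Sigma) by exact: open_cone SE.
have H0 X : cone Sigma X -> 0 < homogeneous_ext phi E X.
  exact: homogeneous_ext_gt0.
have oA : open (cone Sigma `&` eball 1) by apply: openI => //; exact: open_eball.
have A1 X : (cone Sigma `&` eball 1) X -> enorm X <= 1 by move=> [_ /ltW].
have rhs0 X : (cone Sigma `&` eball 1) X ->
    0 < homogeneous_ext phi E X `^ (- gamma).
  by move=> [/H0 HX _]; exact: powR_gt0.
have [[W W0 wW] cw lapw latw] := dirichlet_solution_facts oA A1 rhs0 wsol.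
apply: (@singular_growth _ _ (cone Sigma) (homogeneous_ext phi E) w phi
  gamma W) => //.
- by move=> X c; exact: coneZ.
- by move=> X; exact: cone_neq0.
- by move=> X; exact: homogeneous_ext_le.
- by move=> X; exact: homogeneous_ext_continuous.
- move=> X cX; exact: (homogeneous_ext_harmonic oU SE phimu E2 eig cX).
- by move=> X c; exact: homogeneous_extZ.
- by move=> X cX X1; apply: wW.
- by move=> X cX X1; apply: cw.
- by move=> X cX X1; apply: lapw.
Qed.

(* The dimension is n = m + 2. *)
Theorem theorem1p3 (R : realType) (m : nat) (gamma rad lam Lam L : R)
    (Sigma : set 'rV[R]_m.+2) (phi : R) (E : 'rV[R]_m.+2 -> R)
    (gamma_gt0 : 0 < gamma) (rad_gt0 : 0 < rad)
    (lam_gt0 : 0 < lam) (lam_le : lam <= Lam)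
    (Sigma_dom : spherical_domain Sigma)
    (Sigma_lip : lipschitz_boundary Sigma)
    (phiP : frequency Sigma phi)
    (EP : first_dirichlet_eigenfunction Sigma E)
    (critical : phi = 2 / (1 + gamma))
    (w_ex : exists w : 'rV[R]_m.+2 -> R,
       dirichlet_solution (cone Sigma `&` eball 1)
         (fun X => homogeneous_ext phi E X `^ (- gamma)) w)
    (rho : R) (rho_lt : rho < 2 * rad) :
  exists C : R,
  forall (g : 'rV[R]_m.+1 -> R) (f u : 'rV[R]_m.+2 -> R),
    g 0 = 0 ->
    (C01_norm (cball (3 * rad)) g <= L%:E)%E ->
    holder_continuous (grounded_cylinder g (3 * rad)) f ->
    (forall X, grounded_cylinder g (3 * rad) X -> lam <= f X <= Lam) ->
    singular_solution gamma f g (3 * rad) u ->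
    grounded_cylinder g (3 * rad) `<=` closure (cone Sigma) ->
    forall X, grounded_cylinder g rad X -> enorm X <= rho ->
      u X <= C * rad `^ (- 2 / (1 + gamma))
               * Linfty_norm (grounded_cylinder g (3 * rad)) u
               * (enorm (rad^-1 *: X)) `^ phi
               * (ln (2 * rad / enorm X)) `^ (phi / 2).
Proof.
have [w wsol] := w_ex.
have [C1 [K0 [C10 K00 bound]]] :=
  critical_cone_growth gamma_gt0 critical Sigma_dom phiP EP wsol.
have [nonempty [U [oU SE]] conn] := Sigma_dom.
have sph : Sigma `<=` sphere by rewrite SE; exact: subIsetl.
have [phi0 _] := phiP.
have Lam0 : 0 < Lam by exact: lt_le_trans lam_le.
have g1 : 0 < 1 + gamma by rewrite addr_gt0.
have a0 : 0 < (1 + gamma)^-1 by rewrite invr_gt0.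
have aE : phi / 2 = (1 + gamma)^-1.
  by rewrite critical mulrAC divff ?mul1r// pnatr_eq0.
rewrite aE; set a := (1 + gamma)^-1 in a0 *.
have L1 : 0 < 1 + `|L| by rewrite ltr_pwDl.
pose s := rad / (1 + `|L|).
have s0 : 0 < s by rewrite divr_gt0.
have Ls : (1 + `|L|) * s = rad by rewrite mulrC divfK ?gt_eqF.
(* Inside the ball of radius [r0], the function [w] is defined, the cylinder
   has no side or top, and the logarithm of the statement is at least 1. *)
pose r0 := Num.min 1 (Num.min s (2 * rad * expR (- 1))).
have r00 : 0 < r0 by rewrite !lt_min ltr01 s0 !mulr_gt0 ?expR_gt0.
have /and3P[r01 r0s r0e] : [&& r0 <= 1, r0 <= s & r0 <= 2 * rad * expR (- 1)].
  by have := lexx r0; rewrite {2}/r0 !le_min.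
(* Lower bound for the supremum of [u]. *)
pose c0 := (lam * s ^+ 2 / (4 * m.+2%:R)) `^ a.
have c00 : 0 < c0 by rewrite powR_gt0// divr_gt0 ?mulr_gt0 ?exprn_gt0.
(* [1 + ln (1 / |X|) <= B * ln (2 * rad / |X|)] near the origin. *)
pose B := 1 + `|1 - ln (2 * rad)|.
have B0 : 0 < B by rewrite ltr_pwDl.
(* [P] serves near the origin, [Q] away from it, and [T] collects the powers
   of [rad] that the scale invariant form of the estimate introduces. *)
pose P := (1 + Lam * (1 + gamma)) * (C1 * B) `^ a / c0 + K0 * r0^-1 `^ phi.
pose Q := (r0 `^ phi * ln (2 * rad / rho) `^ a)^-1.
pose T := rad `^ (- 2 / (1 + gamma)) * rad^-1 `^ phi.
have T0 : 0 < T by rewrite mulr_gt0// powR_gt0 ?invr_gt0.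
have k0 : 0 < 1 + Lam * (1 + gamma) by rewrite addr_gt0 ?mulr_gt0.
have P0 : 0 <= P.
  rewrite /P addr_ge0 ?mulr_ge0 ?powR_ge0 ?invr_ge0 ?(ltW k0) ?(ltW c00) ?(ltW K00)//.
have Q0 : 0 <= Q by rewrite invr_ge0 mulr_ge0 ?powR_ge0.
exists ((P + Q) / T) => g f u g0 gC01 _ fb usol GCcone X GX Xrho.
set GC := grounded_cylinder g (3 * rad) in fb usol GCcone *.
set N := Linfty_norm GC u.
have r3 : 0 < 3 * rad by rewrite mulr_gt0.
have [L0 glip0] := lipschitz_of_C01_norm (ltW r3) gC01.
have LE : `|L| = L by rewrite ger0_norm.
rewrite LE in Ls L1.
have [[cu C2u] u0 upos equ uG] := usol.
have cGC : compact GC by exact: (compact_grounded_cylinder r3 L0 g0 glip0).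
have uN Y : GC Y -> u Y <= N.
  move=> GY; apply: (le_trans (ler_norm _)).
  have [M uM] := compact_norm_bound cGC cu.
  by apply: ub_le_sup; [exists M => _ [Z GZ <-]; exact: uM | exists Y].
have GX3 : GC X.
  case: GX => hX /andP[h0 hr]; split.
    by rewrite (le_trans hX)// ler_peMl ?ler1n// ltW.
  by rewrite h0 (le_trans hr)// ler_peMl ?ler1n// ltW.
have Lsr : (1 + L) * s < 3 * rad / 2 by rewrite Ls; lra.
have icenter : GC° (cylinder_center (3 * rad)).
  apply: (ball_in_grounded_cylinder r3 L0 g0 glip0 Lsr).
  by rewrite subrr enorm0 ltW.
have N0 : 0 < N.
  apply: lt_le_trans (upos _ icenter) _; apply: uN.
  exact: (interior_subset icenter).
have c0N : c0 <= N.
  have fl Y : GC° Y -> lam <= f Y by move=> /interior_subset/fb/andP[].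
  have := singular_solution_lower_bound r3 L0 g0 glip0 gamma_gt0 lam_gt0 fl usol
    N0 uN s0 Lsr.
  move=> low; rewrite -[N]powRr1 ?(ltW N0)// -(@mulfV _ (1 + gamma)) ?gt_eqF//.
  rewrite powRrM; apply: (ge0_ler_powR (ltW a0)) => //.
    by rewrite nnegrE ltW// divr_gt0 ?mulr_gt0 ?exprn_gt0.
  by rewrite nnegrE powR_ge0.
set l := ln (2 * rad / enorm X).
have -> : (P + Q) / T * rad `^ (- 2 / (1 + gamma)) * N *
    enorm (rad^-1 *: X) `^ phi * l `^ a = (P + Q) * (N * enorm X `^ phi * l `^ a).
  rewrite enormZ_ge0 ?invr_ge0 ?(ltW rad_gt0)// powRM ?invr_ge0 ?enorm_ge0 ?(ltW rad_gt0)//.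
  have T1 : T^-1 * (rad `^ (- 2 / (1 + gamma)) * rad^-1 `^ phi) = 1.
    by rewrite mulVf// gt_eqF.
  transitivity ((P + Q) * (T^-1 * (rad `^ (- 2 / (1 + gamma)) * rad^-1 `^ phi))
     * (N * enorm X `^ phi * l `^ a)); first by ring.
  by rewrite T1 mulr1.
have R0 : 0 <= N * enorm X `^ phi * l `^ a by rewrite !mulr_ge0 ?powR_ge0 ?ltW.
have [Xr0|r0X] := ltP (enorm X) r0; last first.
  have Xpos : 0 < enorm X by exact: lt_le_trans r0X.
  have rho0 : 0 < rho by exact: lt_le_trans Xrho.
  have lrho : 0 < ln (2 * rad / rho) by rewrite ln_gt0// ltr_pdivlMr// mul1r.
  have lX : ln (2 * rad / rho) <= l.
    rewrite ler_ln ?posrE ?divr_gt0 ?mulr_gt0// ler_pM2l ?mulr_gt0//.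
    by rewrite lef_pV2.
  apply: (@le_trans _ _ (Q * (N * enorm X `^ phi * l `^ a))); last first.
    by rewrite ler_wpM2r// lerDr.
  apply: (le_trans (uN _ GX3)).
  have -> : Q * (N * enorm X `^ phi * l `^ a) = N * (Q * (enorm X `^ phi * l `^ a)).
    by ring.
  rewrite ler_peMr ?(ltW N0)// /Q ler_pdivlMl ?mulr_gt0 ?powR_gt0// mulr1.
  apply: ler_pM; rewrite ?powR_ge0//.
    by apply: (ge0_ler_powR (ltW phi0)) => //; rewrite nnegrE ltW.
  apply: (ge0_ler_powR (ltW a0)) => //; rewrite nnegrE ltW//.
  exact: lt_le_trans lX.
have Lr0 : (1 + L) * r0 < 3 * rad.
  by apply: (@le_lt_trans _ _ ((1 + L) * s)); [rewrite ler_pM2l | rewrite Ls; lra].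
have [[XG _]|iX] := grounded_cylinder_near0 r3 L0 g0 glip0 r00 Lr0 GX3 Xr0.
  have -> : u X = 0 by apply: uG.
  by apply: mulr_ge0 => //; exact: addr_ge0.
pose D := GC° `&` eball r0.
have oD : open D by apply: openI; [exact: open_interior | exact: open_eball].
have DK : D `<=` cone Sigma `&` eball 1.
  move=> Y [iY Yr]; split; last exact: lt_le_trans Yr r01.
  apply: (interior_closure_cone sph Sigma_lip (@open_interior _ GC) _ iY).
    by move=> Z /interior_subset; exact: GCcone.
  exact: (interior_grounded_cylinder_neq0 g0 iY).
have latu : nonpos_on_boundary D r0 u.
  move=> p clp np pr eps eps0.
  have Gp : GC p.
    apply: (closed_grounded_cylinder L0 glip0).
    by apply: closureS clp => Y [/interior_subset].
  have [Gam|ip] := grounded_cylinder_near0 r3 L0 g0 glip0 r00 Lr0 Gp pr; last first.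
    by exfalso; apply: np.
  apply: filterS (within_vanishing cu Gp (uG _ Gam) eps0) => Y uY [iY _].
  by apply: le_lt_trans (ler_norm _) _; apply: uY; exact: (interior_subset iY).
have DX : D X by [].
have := bound Lam D f u r0 N Lam0 oD DK _ _ _ _ latu r00 N0 _ X DX Xr0.
move=> /(_ _ _ _ _ _)/le_trans; apply.
- by move=> Y [iY _]; have [] := C2u _ iY.
- by move=> Y [iY _]; exact: upos.
- by move=> Y [/interior_subset/fb/andP[]].
- move=> Y [iY _]; rewrite -(equ _ iY) opprK.
  exact: (C2_is_lap (@open_interior _ GC) C2u).
- by move=> Y [/interior_subset GY _] _; exact: uN.
apply: (@le_trans _ _ (P * (N * enorm X `^ phi * l `^ a))); last first.
  by rewrite ler_wpM2r// lerDl.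
have [cX X1] := DK _ DX.
have Xpos : 0 < enorm X by rewrite enorm_gt0; exact: cone_neq0 cX.
have l1 : 1 <= l.
  rewrite -ler_expR /l lnK ?posrE ?divr_gt0 ?mulr_gt0//.
  rewrite ler_pdivlMr// mulrC -ler_pdivlMr ?expR_gt0// -expRN.
  exact: (le_trans (ltW Xr0)).
have la1 : 1 <= l `^ a.
  have one : (1 : R) = 1 `^ a by rewrite powR1.
  rewrite {1}one; apply: (ge0_ler_powR (ltW a0)); rewrite ?nnegrE//.
  exact: le_trans l1.
have lnX : 0 <= ln (enorm X)^-1.
  by rewrite ln_ge0// -[leLHS]invr1 lef_pV2 ?posrE// ltW.
have logb : 1 + ln (enorm X)^-1 <= B * l.
  have lE : l = ln (2 * rad) + ln (enorm X)^-1.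
    by rewrite /l lnM ?posrE ?invr_gt0 ?mulr_gt0.
  have h1 := ler_norm (1 - ln (2 * rad)).
  have h2 : `|1 - ln (2 * rad)| <= `|1 - ln (2 * rad)| * l.
    by rewrite ler_peMr.
  by rewrite /B mulrDl mul1r; move: h1 h2; rewrite lE; move: `|_| => *; lra.
have first_term : (C1 * (1 + ln (enorm X)^-1)) `^ a <= (C1 * B) `^ a * l `^ a.
  rewrite -powRM ?mulr_ge0 ?(ltW C10) ?(ltW B0)//; last exact: le_trans l1.
  apply: (ge0_ler_powR (ltW a0)); rewrite ?nnegrE.
  - by rewrite mulr_ge0 ?addr_ge0 ?(ltW C10).
  - by rewrite !mulr_ge0 ?(ltW C10) ?(ltW B0)// (le_trans _ l1).
  - by rewrite -mulrA ler_pM2l.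
rewrite /P [leRHS]mulrDl; apply: lerD.
  rewrite -[leLHS]mulrA -!(mulrA (1 + Lam * (1 + gamma))) ler_pM2l//.
  apply: (@le_trans _ _ ((C1 * B) `^ a * l `^ a * enorm X `^ phi)).
    by rewrite ler_wpM2r ?powR_ge0.
  have -> : (C1 * B) `^ a / c0 * (N * enorm X `^ phi * l `^ a) =
    (N / c0) * ((C1 * B) `^ a * l `^ a * enorm X `^ phi) by ring.
  rewrite ler_peMl ?mulr_ge0 ?powR_ge0//.
  by rewrite ler_pdivlMr// mul1r.
rewrite powRM ?enorm_ge0 ?invr_ge0 ?(ltW r00)//.
have -> : K0 * N * (enorm X `^ phi * r0^-1 `^ phi) =
  K0 * r0^-1 `^ phi * (N * enorm X `^ phi) * 1 by ring.
rewrite [leRHS]mulrA; apply: ler_wpM2l => //.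
by rewrite !mulr_ge0 ?powR_ge0 ?(ltW K00) ?(ltW N0).
Qed.
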